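(* Let $k\ge 1$ be an integer and let $\gamma\colon[0,2\pi)\to S^{2k-1}$ be defined by \[ \gamma(\theta):=\frac{1}{\sqrt{k}}\big(\cos\theta,\ \sin\theta,\ \cos2\theta,\ \sin2\theta,\ \ldots,\ \cos k\theta,\ \sin k\theta\big). \] Then $\gamma$ is a spherical $2$-design curve in $S^{2k-1}$, and its length equals \[ 2\pi\sqrt{\frac{A_{2,2k-1}}{B_{2,2k-1}}}, \] where $A_{2,2k-1}=2\sum_{n=1}^{k}n^2$ and $B_{2,2k-1}=2k$, which is a lower bound on the length of every spherical $2$-design curve in $S^{2k-1}$. In particular, $\gamma$ has minimal length among all spherical $2$-design curves in $S^{2k-1}$.
   Context: $S^d$ is the unit sphere in $\mathbb{R}^{d+1}$, $\sigma$ is the uniform (rotation-invariant) probability measure on $S^d$, and $\Pi_d^t$ is the vector space of restrictions to $S^d$ of real polynomials on $\mathbb{R}^{d+1}$ of degree at most $t$. Let $\gamma\colon[0,2\pi)\to S^d$ be a Lipschitz parameterization of a closed rectifiable curve (closed: $\gamma(\theta)\to\gamma(0)$ as $\theta\to 2\pi^-$), with arclength (length) $L(\gamma):=\int_0^{2\pi}\|\gamma'(\theta)\|\,d\theta$ (positive, so that the following formula makes sense). The curve $\gamma$ is a spherical $t$-design curve in $S^d$ if for all $f\in\Pi_d^t$, \[ \int_{S^d}f(x)\,d\sigma(x)=\frac{1}{L(\gamma)}\int_0^{2\pi}f(\gamma(\theta))\,\|\gamma'(\theta)\|\,d\theta. \] *)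

(* Defs.v *)
From HB Require Import structures.
From mathcomp Require Import all_boot all_order all_algebra.
From mathcomp Require Import all_classical all_reals all_analysis.
(* The notations of mpoly clash with those of the analysis library. *)
From mathcomp Require Import (canonicals, coercions) mpoly.

Set Implicit Arguments.
Unset Strict Implicit.
Unset Printing Implicit Defensive.

Import Order.TTheory GRing.Theory Num.Theory.
Import numFieldNormedType.Exports.

Local Open Scope classical_set_scope.
Local Open Scope ring_scope.

(* The canonical norm of the library on ['rV[R]_n] is the sup norm; it gives
   the usual topology, derivatives and Lipschitz maps, but not the lengths. *)
Definition eucl_norm (R : realType) (n : nat) (x : 'rV[R]_n) : R :=
  Num.sqrt (\sum_(i < n) x 0 i ^+ 2).

Definition sphere (R : realType) (d : nat) : set 'rV[R]_d.+1 :=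
  [set x | eucl_norm x = 1].
Arguments sphere : clear implicits.

Notation borel_rV R n := (g_sigma_algebraType (@open 'rV[R]_n)).

Definition is_rotation (R : realType) (n : nat) (M : 'M[R]_n) : Prop :=
  M *m M^T = 1%:M /\ \det M = 1.

(* The measure on S^d is presented as a Borel probability on R^(d+1) carried by
   S^d. For d >= 1 there is exactly one rotation-invariant such probability
   (for d = 0 the only rotation is the identity). *)
Definition uniform_on_sphere (R : realType) (d : nat)
    (sigma : probability (borel_rV R d.+1) R) : Prop :=
  sigma (sphere R d) = 1%E /\
  forall M : 'M[R]_d.+1, is_rotation M ->
  forall A : set (borel_rV R d.+1), measurable A ->
    sigma [set x : 'rV[R]_d.+1 | A (x *m M)] = sigma A.

(* Functions on S^d are represented by functions on R^(d+1) whose values off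
   S^d are irrelevant. [msize p] is the total degree plus one, and 0 for
   [p = 0]. *)
Definition sphere_poly (R : realType) (d t : nat) : set ('rV[R]_d.+1 -> R) :=
  [set f | exists2 p : mpoly.mpoly d.+1 R, (mpoly.msize p <= t.+1)%N &
     forall x, sphere R d x -> f x = mpoly.meval (fun i => x 0 i) p].
Arguments sphere_poly : clear implicits.

(* A curve is a total function on R of which only the restriction to [0, 2pi[
   matters. *)
Definition closed_lipschitz_curve (R : realType) (d : nat)
    (c : R -> 'rV[R]_d.+1) : Prop :=
  [/\ forall theta : R, theta \in `[0, 2 * pi[ -> sphere R d (c theta),
      [lipschitz c theta | theta in `[0, 2 * pi[%classic] &
      c theta @[theta --> (2 * pi)^'-] --> c 0].

(* By Rademacher's theorem the derivative of a Lipschitz curve exists almost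
   everywhere; the default value taken by [derive1] elsewhere (and at the end
   point 0, where it is two-sided) does not affect the integral. *)
Definition speed (R : realType) (d : nat) (c : R -> 'rV[R]_d.+1) (theta : R)
    : R :=
  eucl_norm (derive1 c theta).

Definition curve_length (R : realType) (d : nat) (c : R -> 'rV[R]_d.+1) : R :=
  \int[@lebesgue_measure R]_(theta in `[0, 2 * pi[) speed c theta.

Definition design_curve (R : realType) (d : nat)
    (sigma : probability (borel_rV R d.+1) R) (t : nat)
    (c : R -> 'rV[R]_d.+1) : Prop :=
  [/\ closed_lipschitz_curve c,
      0 < curve_length c &
      forall f, sphere_poly R d t f ->
        \int[sigma]_(x in sphere R d) f x =
        (curve_length c)^-1 *
        \int[@lebesgue_measure R]_(theta in `[0, 2 * pi[)
          (f (c theta) * speed c theta)].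

(* With coordinates numbered from 0, the coordinates 2m and 2m+1 are
   cos((m+1) theta) / sqrt k and sin((m+1) theta) / sqrt k. *)
Definition trig_curve (R : realType) (k : nat) (theta : R)
    : 'rV[R]_(2 * k - 1).+1 :=
  (Num.sqrt k%:R)^-1 *:
  \row_j (if odd j then sin ((j./2.+1)%:R * theta)
          else cos ((j./2.+1)%:R * theta)).

Definition A2 (R : realType) (k : nat) : R :=
  2 * \sum_(1 <= n < k.+1) n%:R ^+ 2.

Definition B2 (R : realType) (k : nat) : R := 2 * k%:R.

(* Main.v *)
Require Import Defs.
From HB Require Import structures.
From mathcomp Require Import all_boot all_order all_algebra.
From mathcomp Require Import all_classical all_reals all_analysis.
From mathcomp Require Import measurable_realfun perm.
From mathcomp Require Import (canonicals, coercions) mpoly.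
From mathcomp Require Import ring lra zify.

Set Implicit Arguments.
Unset Strict Implicit.
Unset Printing Implicit Defensive.

Import Order.TTheory GRing.Theory Num.Theory.
Import numFieldNormedType.Exports.

Local Open Scope classical_set_scope.
Local Open Scope ring_scope.

(* For the lower bound, cut the design curve into N arcs of equal length L / N.
   The N division points form a closed polygon on the sphere with edges of
   length at most L / N, and up to O(1 / N) their first and second empirical
   moments are those of the curve, hence those of the sphere: 0 and I / (2 k).
   So the 2 k coordinate sequences are almost orthogonal to each other and to
   the constants. A discrete Fourier transform diagonalises the sum of the
   squared edges, with eigenvalues 2 - 2 cos (2 pi m / N), and by Bessel's
   inequality each frequency carries at most N / (2 k) + O(1) of the total
   energy N. The sum of the squared edges is therefore least when the
   frequencies 1, ..., k, -1, ..., -k are filled equally; as N tends to infinity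
   this gives L ^ 2 >= (2 pi) ^ 2 * (2 \sum_(n <= k) n ^ 2) / (2 k).
   Working with division points avoids reparametrizing the curve. That chords
   are bounded by the integral of the speed rests on the fundamental theorem of
   calculus for Lipschitz functions.

   The moments of the sphere come from its invariance under quarter turns in
   coordinate planes; the trigonometric curve has constant speed and the same
   moments, so it integrates all polynomials of degree at most 2. *)

(** * Discrete Fourier analysis of closed polygons *)

Section DiscreteFourier.
Context {R : realType}.
Implicit Types (x : nat -> R) (a : R).

(** Real part and, up to sign, imaginary part of the discrete Fourier coefficient of [x] at angle
    [a]. *)
Definition cos_sum (N : nat) a x := \sum_(j < N) x j * cos (a * j%:R).
Definition sin_sum (N : nat) a x := \sum_(j < N) x j * sin (a * j%:R).
Definition power_spectrum N a x := cos_sum N a x ^+ 2 + sin_sum N a x ^+ 2.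

Definition mode (N m : nat) : R := 2 * pi / N%:R * m%:R.
(** This is |exp(i b) - 1|^2 for b = [mode N m]: an eigenvalue of the negative cyclic second
    difference. *)
Definition laplace_eig (N m : nat) : R := 2 - 2 * cos (mode N m).

Lemma cosDn2pi (x : R) n : cos (x + 2 * pi * n%:R) = cos x.
Proof.
have -> : 2 * pi * n%:R = (pi *+ 2) *+ n :> R by rewrite mulr_natr mulr_natl.
exact/periodicn/cosD2pi.
Qed.

Lemma sinDn2pi (x : R) n : sin (x + 2 * pi * n%:R) = sin x.
Proof.
have -> : 2 * pi * n%:R = (pi *+ 2) *+ n :> R by rewrite mulr_natr mulr_natl.
exact/periodicn/sinD2pi.
Qed.

Lemma mode_period N m : (0 < N)%N -> mode N m * N%:R = 2 * pi * m%:R.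
Proof. by move=> N0; rewrite /mode mulrAC divfK// pnatr_eq0 -lt0n. Qed.

(** Since 1 - cos b = 2 sin(b / 2)^2, it suffices that half the angle lies strictly between 0 and
    pi. *)
Lemma cos_mode_neq1 N r : (0 < r < N)%N -> cos (mode N r) != 1.
Proof.
move=> /andP[r0 rN].
have N0 : (0 : R) < N%:R by rewrite ltr0n (leq_ltn_trans _ rN).
rewrite (_ : mode N r = (mode N r / 2) *+ 2); last by rewrite -mulr_natr divfK.
rewrite cos_mulr2n cos2sin2.
suff : 0 < sin (mode N r / 2).
  move=> s0; have := exprn_gt0 2 s0; rewrite -mulr_natr => h.
  by apply/eqP => e; lra.
have -> : mode N r / 2 = pi * (r%:R / N%:R) by rewrite /mode; field; rewrite gt_eqF.
apply: sin_gt0_pi; rewrite mulr_gt0 ?pi_gt0 ?divr_gt0 ?(ltr0n _ r)//=.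
by rewrite -[ltRHS]mulr1 ltr_pM2l ?pi_gt0// ltr_pdivrMr// mul1r ltr_nat.
Qed.

(* The vector of the two sums is fixed by a rotation of angle [mode N r]. *)
Lemma sum_cos_mode0 N r : (0 < r < N)%N ->
  \sum_(m < N) cos (mode N r * m%:R) = 0.
Proof.
move=> /[dup] rN /cos_mode_neq1; set b := mode N r => b1.
have N0 : (0 < N)%N by case/andP: rN => _; apply: leq_ltn_trans.
pose C := \sum_(m < N) cos (b * m%:R); pose S := \sum_(m < N) sin (b * m%:R).
have shift (f : R -> R) : (forall z, f (z + 2 * pi * r%:R) = f z) ->
    \sum_(m < N) f (b * m%:R + b) = \sum_(m < N) f (b * m%:R).
  move=> per; transitivity (\sum_(m < N) f (b * m.+1%:R)).
    by apply: eq_bigr => m _; rewrite -natr1 mulrDr mulr1.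
  case: N N0 @b {rN b1 C S} => // n _ b.
  rewrite big_ord_recr/= [RHS]big_ord_recl/= addrC; congr +%R => //.
  by rewrite mode_period// mulr0 -[in LHS](add0r (_ * r%:R)) per.
have eC : C = cos b * C - sin b * S.
  rewrite /C -[LHS](shift _ (fun z => cosDn2pi z r)) !mulr_sumr -sumrB.
  by apply: eq_bigr => m _; rewrite cosD; ring.
have eS : S = cos b * S + sin b * C.
  rewrite /S -[LHS](shift _ (fun z => sinDn2pi z r)) !mulr_sumr -big_split.
  by apply: eq_bigr => m _; rewrite /= sinD; ring.
have h : (2 - 2 * cos b) * (C ^+ 2 + S ^+ 2) = 0.
  rewrite (_ : _ * _ = ((1 - cos b) ^+ 2 + (1 - cos b ^+ 2)) * (C ^+ 2 + S ^+ 2)); last ring.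
  rewrite -sin2cos2.
  rewrite (_ : _ * _ = ((C - (cos b * C - sin b * S)) ^+ 2
     + (S - (cos b * S + sin b * C)) ^+ 2)); last by ring.
  by rewrite -eC -eS !subrr expr0n/= addr0.
move/eqP : h; rewrite mulf_eq0 => /orP[/eqP h|].
  by move/eqP: b1; case; lra.
by rewrite paddr_eq0 ?sqr_ge0// !sqrf_eq0 => /andP[/eqP].
Qed.

(** The phase 2 pi m j / N is symmetric in frequency and position, which turns sums over frequencies
    into those of [sum_cos_mode0]. *)
Lemma mode_mul N m j : mode N m * j%:R = mode N j * m%:R.
Proof. by rewrite /mode mulrAC. Qed.

(** Expanding the squares gives a double sum over positions [j] and [l]; after summation over all
    frequencies the terms with [j != l] cancel by [sum_cos_mode0]. *)
Lemma discrete_parseval N x : (0 < N)%N ->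
  \sum_(m < N) power_spectrum N (mode N m) x = N%:R * \sum_(j < N) x j ^+ 2.
Proof.
move=> N0.
have E (m : nat) : power_spectrum N (mode N m) x =
    \sum_(j < N) \sum_(l < N) x j * x l * cos (mode N j * m%:R - mode N l * m%:R).
  rewrite /power_spectrum /cos_sum /sin_sum !expr2 !big_distrlr/= -big_split.
  apply: eq_bigr => j _ /=; rewrite -big_split; apply: eq_bigr => l _ /=.
  by rewrite !(mode_mul N m) cosB; ring.
under eq_bigr do rewrite E.
rewrite exchange_big mulr_sumr; apply: eq_bigr => j _ /=.
rewrite exchange_big (bigD1 j)//= [X in _ + X]big1 ?addr0 => [|l lj].
  under eq_bigr do rewrite subrr cos0 mulr1.
  by rewrite sumr_const card_ord -expr2 mulr_natl.
rewrite -mulr_sumr.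
suff -> : \sum_(m < N) cos (mode N j * m%:R - mode N l * m%:R) = 0 by rewrite mulr0.
have {lj} : (j != l :> nat) by rewrite eq_sym.
rewrite neq_ltn => /orP[] jl.
  rewrite -[RHS](@sum_cos_mode0 N (l - j)); last first.
    by rewrite subn_gt0 jl (leq_ltn_trans (leq_subr _ _)).
  by apply: eq_bigr => m _; rewrite -cosN opprB -mulrBl /mode -mulrBr natrB// ltnW.
rewrite -[RHS](@sum_cos_mode0 N (j - l)); last first.
  by rewrite subn_gt0 jl (leq_ltn_trans (leq_subr _ _)).
by apply: eq_bigr => m _; rewrite -mulrBl /mode -mulrBr natrB// ltnW.
Qed.

(** For a closed sequence, shifting the index rotates the Fourier coefficient by the angle [a].
    Taking differences thus multiplies it by exp(i a) - 1, whose squared modulus is the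
    eigenvalue. *)
Lemma power_spectrum_diff N m x : (0 < N)%N -> x N = x 0%N ->
  power_spectrum N (mode N m) (fun j => x j.+1 - x j) =
  laplace_eig N m * power_spectrum N (mode N m) x.
Proof.
move=> N0 xN; rewrite /power_spectrum /laplace_eig; set a := mode N m.
pose C := cos_sum N a x; pose S := sin_sum N a x.
have shift (f : R -> R) : (forall z, f (z + 2 * pi * m%:R) = f z) ->
    \sum_(j < N) x j.+1 * f (a * j.+1%:R) = \sum_(j < N) x j * f (a * j%:R).
  move=> per; case: N N0 @a {C S} xN => // n _ a xN.
  rewrite big_ord_recr/= [RHS]big_ord_recl/= addrC; congr +%R => //.
  by rewrite mode_period// mulr0 xN -[in LHS](add0r (_ * m%:R)) per.
have shC := shift _ (fun z => cosDn2pi z m).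
have shS := shift _ (fun z => sinDn2pi z m).
have aE (j : nat) : a * j%:R = a * j.+1%:R - a by rewrite -natr1 mulrDr mulr1 addrK.
have eC : cos_sum N a (fun j => x j.+1 - x j) = cos a * C + sin a * S - C.
  rewrite /C /S /cos_sum /sin_sum -[in X in cos a * X]shC -shS !mulr_sumr.
  rewrite -big_split/= -sumrB; apply: eq_bigr => j _.
  by rewrite mulrBl {1}aE cosB; ring.
have eS : sin_sum N a (fun j => x j.+1 - x j) = cos a * S - sin a * C - S.
  rewrite /C /S /cos_sum /sin_sum -[in X in sin a * X]shC -[in X in cos a * X]shS !mulr_sumr.
  rewrite -!sumrB; apply: eq_bigr => j _.
  by rewrite mulrBl {1}aE sinB; ring.
rewrite eC eS -/C -/S.
have -> : (2 - 2 * cos a) = (1 - cos a) ^+ 2 + (1 - cos a ^+ 2) by ring.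
by rewrite -sin2cos2; ring.
Qed.

Lemma laplace_eig_ge0 N m : 0 <= laplace_eig N m.
Proof. by rewrite /laplace_eig; have := cos_le1 (mode N m); lra. Qed.

Lemma laplace_eig0 N : laplace_eig N 0 = 0.
Proof. by rewrite /laplace_eig /mode mulr0 cos0; ring. Qed.

Lemma laplace_eig_sym N m : (0 < N)%N -> (m <= N)%N ->
  laplace_eig N (N - m) = laplace_eig N m.
Proof.
move=> N0 mN; rewrite /laplace_eig; congr (_ - _ * _).
rewrite -(cosN (mode N m)) -(cosDn2pi (- _) 1); congr cos.
by rewrite /mode natrB//; field; rewrite pnatr_eq0 -lt0n.
Qed.

Lemma mode_half N m : (0 < N)%N -> (2 * m <= N)%N -> mode N m \in `[0, pi].
Proof.
move=> N0 mN.
have -> : mode N m = pi * ((2 * m)%:R / N%:R) by rewrite /mode natrM; ring.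
have N1 : (0 : R) < N%:R by rewrite ltr0n.
rewrite in_itv/= mulr_ge0 ?pi_ge0// -[leRHS]mulr1 ler_pM2l ?pi_gt0//.
by rewrite ler_pdivrMr// mul1r ler_nat.
Qed.

(** The symmetry [m] to [N - m] reduces to angles in [0, pi], where the cosine decreases. *)
Lemma laplace_eig_le N k m : (0 < N)%N -> (k <= m)%N -> (m + k <= N)%N ->
  laplace_eig N k <= laplace_eig N m.
Proof.
move=> N0 km mkN; wlog m2 : m km mkN / (2 * m <= N)%N => [hw|].
  have [|m2] := leqP (2 * m) N; first exact: hw.
  rewrite -[leRHS]laplace_eig_sym//; last by lia.
  by apply: hw; lia.
rewrite /laplace_eig lerB// ler_pM2l// leNgt ltr_cos -?leNgt ?mode_half//; last by lia.
by rewrite /mode ler_wpM2l ?ler_nat// divr_ge0// mulr_ge0// pi_ge0.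
Qed.

Lemma discrete_dirichlet N x : (0 < N)%N -> x N = x 0%N ->
  N%:R * \sum_(j < N) (x j.+1 - x j) ^+ 2 =
  \sum_(m < N) laplace_eig N m * power_spectrum N (mode N m) x.
Proof.
move=> N0 xN; rewrite -(discrete_parseval (fun j => x j.+1 - x j))//.
by apply: eq_bigr => m _; rewrite power_spectrum_diff.
Qed.

End DiscreteFourier.

(** * Minimal energy of closed polygons with bounded Gram form *)

Section DiscreteEnergy.
Context {R : realType}.

(* Expand [0 <= \sum_j (\sum_i b i * u i j - M * c j) ^+ 2] with
   [b i = \sum_j u i j * c j]. *)
Lemma bessel_sum n N (u : 'I_n -> nat -> R) (c : nat -> R) (M : R) : 0 < M ->
  (forall a : 'I_n -> R, \sum_(j < N) (\sum_i a i * u i j) ^+ 2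
     <= M * \sum_i a i ^+ 2) ->
  \sum_i (\sum_(j < N) u i j * c j) ^+ 2 <= M * \sum_(j < N) c j ^+ 2.
Proof.
move=> M0 uM; pose b i := \sum_(j < N) u i j * c j.
have := uM b; rewrite -/(b _).
set X := \sum_(j < N) _ => XM; set C := \sum_(j < N) _.
set S := \sum_i b i ^+ 2 in XM *.
have SE : \sum_(j < N) (\sum_i b i * u i j) * c j = S.
  under eq_bigr do rewrite mulr_suml.
  rewrite exchange_big; apply: eq_bigr => i _ /=.
  by rewrite expr2 {2}/b mulr_sumr; apply: eq_bigr => j _; rewrite mulrA.
have : 0 <= \sum_(j < N) (\sum_i b i * u i j - M * c j) ^+ 2.
  by apply: sumr_ge0 => j _; exact: sqr_ge0.
have -> : \sum_(j < N) (\sum_i b i * u i j - M * c j) ^+ 2 = X - 2 * M * S + M ^+ 2 * C.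
  rewrite -SE !mulr_sumr -sumrB -big_split; apply: eq_bigr => j _ /=; ring.
move=> h; have {}h : M * S <= M * (M * C) by lra.
by rewrite ler_pM2l// in h.
Qed.

(** The range splits at [k] and after [N - k]: the middle block vanishes and the last one mirrors
    the first. *)
Lemma sum_sym_modes N k (p : nat -> R) : (0 < k)%N -> (2 * k <= N)%N ->
  (forall m, (m <= N)%N -> p (N - m)%N = p m) ->
  (forall m, (k <= m)%N -> (m + k <= N)%N -> p m = 0) ->
  \sum_(1 <= m < N) p m = 2 * \sum_(1 <= m < k) p m.
Proof.
move=> k0 kN psym p0.
rewrite (@big_cat_nat _ _ _ k)//=; last by lia.
rewrite (@big_cat_nat _ _ _ (N - k).+1 k)//=; [|lia..].
rewrite [X in _ + (X + _)]big_nat_cond [X in _ + (X + _)]big1 ?add0r; last first.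
  by move=> i /andP[/andP[ki iN] _]; apply: p0 => //; lia.
rewrite mulrDl mul1r; congr +%R.
rewrite big_nat_rev/= -{1}[(N - k).+1]add1n big_addn.
rewrite (_ : (N - (N - k) = k)%N); last by lia.
by apply: eq_big_nat => i /andP[i1 ik]; rewrite -psym; last lia; congr p; lia.
Qed.

(** A bathtub argument: the energies [q m] have sum [N * T], each is at most [M * N], and [q 0] is
    at most [D]. As eigenvalues grow away from frequency 0, their weighted sum is smallest when the
    lowest frequencies are filled to capacity. *)
Lemma discrete_energy n N k (u : 'I_n -> nat -> R) (M D T : R) :
  (0 < k)%N -> (2 * k <= N)%N -> 0 < M ->
  (forall i, u i N = u i 0%N) ->
  (forall a : 'I_n -> R, \sum_(j < N) (\sum_i a i * u i j) ^+ 2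
     <= M * \sum_i a i ^+ 2) ->
  \sum_i \sum_(j < N) u i j ^+ 2 = T ->
  \sum_i (\sum_(j < N) u i j) ^+ 2 <= D ->
  @laplace_eig R N k * (N%:R * T - D)
    - 2 * (M * N%:R) * \sum_(1 <= m < k) (laplace_eig N k - laplace_eig N m)
  <= N%:R * \sum_i \sum_(j < N) (u i j.+1 - u i j) ^+ 2.
Proof.
move=> k0 kN M0 uN uM uT uD; have N0 : (0 < N)%N by lia.
pose q m := \sum_i power_spectrum N (mode N m) (u i).
have q_ge0 m : 0 <= q m by apply: sumr_ge0 => i _; rewrite addr_ge0 ?sqr_ge0.
have sumq : \sum_(m < N) q m = N%:R * T.
  rewrite exchange_big/= -uT mulr_sumr; apply: eq_bigr => i _.
  exact: discrete_parseval.
have q0 : q 0%N <= D.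
  apply: le_trans uD; rewrite le_eqVlt; apply/orP; left; apply/eqP.
  apply: eq_bigr => i _; rewrite /power_spectrum /cos_sum /sin_sum /mode.
  under eq_bigr do rewrite mulr0 mul0r cos0 mulr1.
  under [X in _ + X ^+ 2]eq_bigr do rewrite mulr0 mul0r sin0 mulr0.
  by rewrite [X in _ + X ^+ 2]big1// expr0n/= addr0.
(* Bessel against the cosine and the sine, whose squares together sum to [N]. *)
have qM m : q m <= M * N%:R.
  rewrite /q /power_spectrum big_split/=.
  apply: le_trans (lerD (bessel_sum (fun j => cos (mode N m * j%:R)) M0 uM)
                        (bessel_sum (fun j => sin (mode N m * j%:R)) M0 uM)) _.
  rewrite -mulrDr -big_split/=; under eq_bigr do rewrite cos2Dsin2.
  by rewrite sumr_const card_ord.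
(* The positive part [p] acts as a dual certificate: [laplace_eig N m >= laplace_eig N k - p m] for
   every [m], while [p] vanishes from [k] to [N - k]. *)
pose p m := Num.max 0 (laplace_eig N k - laplace_eig N m) : R.
have p_ge0 m : 0 <= p m by rewrite /p le_max lexx.
have pE m : (m <= k)%N -> p m = laplace_eig N k - laplace_eig N m.
  by move=> mk; apply/max_idPr; rewrite subr_ge0 laplace_eig_le//; lia.
have sump : \sum_(1 <= m < N) p m =
    2 * \sum_(1 <= m < k) (laplace_eig N k - laplace_eig N m).
  rewrite (@sum_sym_modes N k)//.
  - by congr (_ * _); apply: eq_big_nat => m /andP[_ mk]; rewrite pE// ltnW.
  - by move=> m mN; rewrite /p laplace_eig_sym.
  - by move=> m km mkN; apply/max_idPl; rewrite subr_le0 laplace_eig_le.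
have -> : N%:R * \sum_i \sum_(j < N) (u i j.+1 - u i j) ^+ 2 =
    \sum_(m < N) laplace_eig N m * q m.
  rewrite mulr_sumr; under eq_bigr do rewrite discrete_dirichlet//.
  by rewrite exchange_big; apply: eq_bigr => m _; rewrite mulr_sumr.
apply: (@le_trans _ _ (\sum_(m < N) (laplace_eig N k - p m) * q m)); last first.
  apply: ler_sum => m _; apply: ler_wpM2r => //.
  by rewrite lerBlDl -lerBlDr /p le_max lexx orbT.
under [leRHS]eq_bigr do rewrite mulrBl.
rewrite [leRHS]sumrB -[X in _ <= X - _]mulr_sumr sumq mulrBr -addrA lerD2l -opprD lerN2.
rewrite -(big_mkord xpredT (fun m => p m * q m)) big_ltn//.
apply: lerD.
  by rewrite pE// laplace_eig0 subr0 ler_wpM2l ?laplace_eig_ge0.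
rewrite [2 * _]mulrC -[leRHS]mulrA -sump mulr_sumr; apply: ler_sum => m _.
by rewrite [leRHS]mulrC ler_wpM2l.
Qed.

End DiscreteEnergy.

(** * The polygon bound as the number of vertices tends to infinity *)

Section AsymptoticEnergy.
Context {R : realType}.

(** The main term of the Gram matrix is [N / n] times the identity. The entrywise errors are
    absorbed by |a_i a_l| <= (a_i^2 + a_l^2) / 2, summed over all pairs. *)
Lemma gram_form_le n N (u : 'I_n -> nat -> R) (e : R) :
  (forall i l, `|\sum_(j < N) u i j * u l j - N%:R * ((i == l)%:R / n%:R)|
     <= N%:R * e) ->
  forall a : 'I_n -> R, \sum_(j < N) (\sum_i a i * u i j) ^+ 2
     <= N%:R * (n%:R^-1 + n%:R * e) * \sum_i a i ^+ 2.
Proof.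
move=> uG a; set A := \sum_i a i ^+ 2.
have -> : \sum_(j < N) (\sum_i a i * u i j) ^+ 2 =
    \sum_i \sum_l a i * a l * \sum_(j < N) u i j * u l j.
  under eq_bigr do rewrite expr2 big_distrlr/=.
  rewrite exchange_big; apply: eq_bigr => i _ /=.
  rewrite exchange_big; apply: eq_bigr => l _ /=.
  by rewrite mulr_sumr; apply: eq_bigr => j _; ring.
have diag : \sum_i \sum_l a i * a l * (N%:R * ((i == l)%:R / n%:R)) =
    N%:R * n%:R^-1 * A.
  rewrite mulr_sumr; apply: eq_bigr => i _.
  rewrite (bigD1 i)//= eqxx big1 => [|l li]; first by rewrite /= mulr1n; ring.
  by rewrite eq_sym (negbTE li) mul0r !mulr0.
have offd : \sum_i \sum_(l < n) (a i ^+ 2 + a l ^+ 2) / 2 * (N%:R * e) =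
    N%:R * (n%:R * e) * A.
  transitivity (\sum_(i < n) (n%:R * a i ^+ 2 + A) * (N%:R * e / 2)).
    apply: eq_bigr => i _; rewrite -mulr_suml -mulr_suml big_split/= sumr_const.
    by rewrite card_ord -[_ *+ n]mulr_natl -/A; ring.
  rewrite -mulr_suml big_split/= -mulr_sumr -/A sumr_const card_ord -mulr_natl.
  by field.
rewrite mulrDr mulrDl -diag -offd -big_split; apply: ler_sum => i _ /=.
rewrite -big_split; apply: ler_sum => l _ /=.
rewrite -lerBlDl -mulrBr (le_trans (ler_norm _))// normrM ler_pM//.
rewrite normrM -[a i ^+ 2]real_normK ?num_real// -[a l ^+ 2]real_normK ?num_real//.
by have := sqr_ge0 (`|a i| - `|a l|); lra.
Qed.

(** This is [discrete_energy] with total [N], mean bound [n * (N * e) ^+ 2] and [M] from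
    [gram_form_le]. The factors [N ^+ 2] stay next to the eigenvalues because these products
    converge. *)
Lemma near_design_energy n k N (u : 'I_n -> nat -> R) (e L : R) :
  (0 < n)%N -> (0 < k)%N -> (2 * k <= N)%N -> 0 <= e ->
  (forall i, u i N = u i 0%N) ->
  (forall j, \sum_i u i j ^+ 2 = 1) ->
  (forall i l, `|\sum_(j < N) u i j * u l j - N%:R * ((i == l)%:R / n%:R)|
     <= N%:R * e) ->
  (forall i, `|\sum_(j < N) u i j| <= N%:R * e) ->
  \sum_i \sum_(j < N) (u i j.+1 - u i j) ^+ 2 <= L ^+ 2 / N%:R ->
  N%:R ^+ 2 * laplace_eig N k * (1 - n%:R * e ^+ 2)
   - 2 * (n%:R^-1 + n%:R * e) *
     \sum_(1 <= m < k) (N%:R ^+ 2 * laplace_eig N k - N%:R ^+ 2 * laplace_eig N m)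
  <= L ^+ 2.
Proof.
move=> n0 k0 kN e0 uN u1 uG um uE.
have N0 : (0 : R) < N%:R by rewrite ltr0n; lia.
have n0' : (0 : R) < n%:R by rewrite ltr0n.
have M0 : 0 < N%:R * (n%:R^-1 + n%:R * e).
  by rewrite mulr_gt0// ltr_wpDr ?invr_gt0// mulr_ge0// ltW.
have uT : \sum_i \sum_(j < N) u i j ^+ 2 = N%:R.
  rewrite exchange_big/=; under eq_bigr do rewrite u1.
  by rewrite sumr_const card_ord.
have uD : \sum_i (\sum_(j < N) u i j) ^+ 2 <= n%:R * (N%:R * e) ^+ 2.
  rewrite mulr_natl -[n in leRHS]card_ord -sumr_const; apply: ler_sum => i _.
  by rewrite -real_normK ?num_real// ler_sqr ?nnegrE// mulr_ge0// ltW.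
have := discrete_energy k0 kN M0 uN (gram_form_le uG) uT uD.
have h : N%:R * \sum_i \sum_(j < N) (u i j.+1 - u i j) ^+ 2 <= L ^+ 2.
  by rewrite -ler_pdivlMl// mulrC.
move=> /le_trans /(_ h); apply: le_trans; rewrite le_eqVlt; apply/orP; left.
apply/eqP; under [X in _ - _ * X = _]eq_bigr do rewrite -mulrBr.
by rewrite -mulr_sumr; ring.
Qed.

(** With v = pi m / N the eigenvalue is 4 sin(v)^2, and sin(v) / v tends to 1. *)
Lemma cvg_laplace_eig m :
  (N%:R ^+ 2 * laplace_eig N m : R) @[N --> \oo] --> (2 * pi * m%:R) ^+ 2.
Proof.
have sinx : (h^-1 * sin h : R) @[h --> 0^'] --> (1 : R).
  have /derivableP := @derivable_sin R 0.
  have := @is_derive_sin R 0; rewrite cos0 => d1.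
  have d2 : derivable (@sin R) 0 1 by [].
  have := @derive_val _ _ _ _ _ _ _ d1; rewrite /derive => e _.
  have : cvg (h^-1 *: ((@sin R \o shift 0) (h *: 1) - sin 0) @[h --> 0^']) by [].
  rewrite e; under eq_fun do rewrite /= sin0 subr0 addr0 /GRing.scale/= mulr1.
  by [].
have [->|m0] := eqVneq m 0%N.
  rewrite mulr0 expr0n/=; under eq_fun do rewrite laplace_eig0 mulr0.
  exact: cvg_cst.
have b0 : (pi * m%:R : R) != 0 by rewrite mulf_neq0 ?gt_eqF ?pi_gt0// ltr0n lt0n.
(* Passing to [N.+1] avoids division by 0; then half the mode is [v N], a nonzero multiple of the
   harmonic sequence. *)
rewrite -cvg_shiftS.
pose v N : R := pi * m%:R * harmonic N.
have v0 : v @ \oo --> (0 : R).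
  rewrite -[X in _ --> X](mulr0 (pi * m%:R)).
  by apply: cvgM; [exact: cvg_cst|exact: cvg_harmonic].
have vn0 N : v N != 0 by rewrite mulf_neq0// gt_eqF// harmonic_gt0.
have sv := (cvgr_dnbhsP _ _ _).1 sinx v (conj vn0 v0).
have -> : (fun N : nat => N.+1%:R ^+ 2 * laplace_eig N.+1 m : R) =
    (fun N => (2 * pi * m%:R * ((v N)^-1 * sin (v N))) ^+ 2).
  apply/funext => N.
  have N0 : (N.+1%:R : R) != 0 by rewrite pnatr_eq0.
  rewrite /laplace_eig (_ : mode N.+1 m = v N *+ 2); last first.
    by rewrite /mode /v /harmonic/=; field.
  rewrite cos_mulr2n cos2sin2; move: (sin (v N)) => s; rewrite /v /harmonic/=.
  have := @pi_gt0 R; move: (pi : R) => p p0; field.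
  by rewrite nat1r N0 pnatr_eq0 m0 gt_eqF.
have c : 2 * pi * m%:R * ((v N)^-1 * sin (v N)) @[N --> \oo] --> 2 * pi * m%:R * 1.
  by apply: cvgM => //; exact: cvg_cst.
rewrite mulr1 in c; under eq_fun do rewrite expr2.
by rewrite expr2; apply: cvgM.
Qed.

Lemma asymptotic_energy n k (L : R) : n = (2 * k)%N -> (0 < k)%N -> 0 <= L ->
  (forall N, (2 * k <= N)%N -> exists u : 'I_n -> nat -> R,
    [/\ forall i, u i N = u i 0%N,
        forall j, \sum_i u i j ^+ 2 = 1,
        forall i l,
          `|\sum_(j < N) u i j * u l j - N%:R * ((i == l)%:R / n%:R)|
          <= N%:R * (2 * L / N%:R),
        forall i, `|\sum_(j < N) u i j| <= N%:R * (2 * L / N%:R) &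
        \sum_i \sum_(j < N) (u i j.+1 - u i j) ^+ 2 <= L ^+ 2 / N%:R]) ->
  (2 * pi) ^+ 2 * ((2 * \sum_(1 <= m < k.+1) m%:R ^+ 2) / (2 * k%:R)) <= L ^+ 2.
Proof.
move=> nk k0 L0 hu.
have n0 : (0 < n)%N by rewrite nk muln_gt0.
pose F (N : nat) : R :=
  N%:R ^+ 2 * laplace_eig N k * (1 - n%:R * (2 * L * N%:R^-1) ^+ 2)
   - 2 * (n%:R^-1 + n%:R * (2 * L * N%:R^-1)) *
     \sum_(1 <= m < k) (N%:R ^+ 2 * laplace_eig N k - N%:R ^+ 2 * laplace_eig N m).
have FL N : (2 * k <= N)%N -> F N <= L ^+ 2.
  move=> kN; have [u [uN u1 uG um uE]] := hu _ kN.
  by apply: near_design_energy uE => //; rewrite divr_ge0// mulr_ge0.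
have V0 : (N%:R^-1 : R) @[N --> \oo] --> (0 : R).
  by rewrite -cvg_shiftS; exact: cvg_harmonic.
have E0 : (2 * L * N%:R^-1 : R) @[N --> \oo] --> (0 : R).
  by rewrite -[X in _ --> X](mulr0 (2 * L)); apply: cvgM => //; exact: cvg_cst.
have E2 : ((2 * L * N%:R^-1) ^+ 2 : R) @[N --> \oo] --> (0 ^+ 2 : R).
  by under eq_fun do rewrite expr2; rewrite expr2; apply: cvgM.
have Fl : F N @[N --> \oo] -->
    (2 * pi * k%:R) ^+ 2 * (1 - n%:R * 0 ^+ 2) - 2 * (n%:R^-1 + n%:R * 0) *
    \sum_(1 <= m < k) ((2 * pi * k%:R) ^+ 2 - (2 * pi * m%:R) ^+ 2).
  apply: cvgB; apply: cvgM.
  - exact: cvg_laplace_eig.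
  - by apply: cvgB; [exact: cvg_cst|apply: cvgM => //; exact: cvg_cst].
  - apply: cvgM; first exact: cvg_cst.
    by apply: cvgD; [exact: cvg_cst|apply: cvgM => //; exact: cvg_cst].
  - apply: cvg_big => [|m _]; first exact: add_continuous.
    by apply: cvgB; exact: cvg_laplace_eig.
(* As 2 / n = 1 / k, the limit equals (2 pi)^2 times k^2 - (1/k) \sum_(m < k) (k^2 - m^2), which is
   (1/k) \sum_(m <= k) m^2. *)
suff -> : (2 * pi) ^+ 2 * ((2 * \sum_(1 <= m < k.+1) m%:R ^+ 2) / (2 * k%:R)) =
    (2 * pi * k%:R) ^+ 2 * (1 - n%:R * 0 ^+ 2) - 2 * (n%:R^-1 + n%:R * 0) *
    \sum_(1 <= m < k) ((2 * pi * k%:R) ^+ 2 - (2 * pi * m%:R) ^+ 2) :> R.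
  rewrite -(cvg_lim _ Fl)//; apply: limr_le; first by apply/cvg_ex; eexists; exact: Fl.
  by exists (2 * k)%N => // N /= nN; exact: FL.
rewrite big_nat_recr//= sumrB sumr_const_nat -[_ *+ (k - 1)]mulr_natl natrB//.
under [X in _ = _ - _ * (_ - X)]eq_bigr do rewrite exprMn.
rewrite -mulr_sumr nk natrM expr0n/= !mulr0 addr0 subr0.
have : (k%:R : R) != 0 by rewrite pnatr_eq0 -lt0n.
move: (k%:R : R) (\sum_(_ <= _ < _) _) (pi : R) => K S p K0.
by field.
Qed.

End AsymptoticEnergy.

(** * Lipschitz functions and null sets *)

Lemma lebesgue_measure_itv_lty (R : realType) (x y : bool) (a b : R) :
  (@lebesgue_measure R [set` Interval (BSide x a) (BSide y b)] < +oo)%E.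
Proof. by rewrite lebesgue_measure_itv/=; case: ifPn => // _; exact: ltry. Qed.

Lemma fine_lebesgue_measure_itv (R : realType) (x y : bool) (a b : R) : a <= b ->
  fine (@lebesgue_measure R [set` Interval (BSide x a) (BSide y b)]) = b - a.
Proof.
rewrite lebesgue_measure_itv/= lte_fin le_eqVlt => /predU1P[->|->//].
by rewrite ltxx subrr.
Qed.

Lemma le_integrable_bounded d (T : measurableType d) (R : realType)
    (mu : {measure set T -> \bar R}) (A : set T) (f : T -> R) (M : R) :
  measurable A -> (mu A < +oo)%E -> measurable_fun A f ->
  (forall x, A x -> `|f x| <= M) -> mu.-integrable A (EFin \o f).
Proof.
move=> mA muA mf fM; apply: measurable_bounded_integrable => //.
exists M; split; first exact: num_real.
by move=> N MN x Ax /=; apply: le_trans (ltW MN); exact: fM.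
Qed.

Section LipschitzFTC.
Context {R : realType}.
Notation mu := (@lebesgue_measure R).
Variables (F : R -> R) (K : R).
Hypothesis FK : forall x y, `|F x - F y| <= K * `|x - y|.

Let lip_ge0 : 0 <= K.
Proof. by have := FK 1 0; rewrite subr0 normr1 mulr1; exact: le_trans. Qed.

Lemma lipschitz_real_continuous : continuous F.
Proof.
move=> x; apply/cvgrPdist_lt => e e0.
(* [K] may be 0, so the divisor is [K + 1]. *)
have K1 : 0 < K + 1 by rewrite ltr_wpDl.
near=> t; rewrite (le_lt_trans (FK x t))//.
rewrite (@le_lt_trans _ _ ((K + 1) * `|x - t|))//.
  by rewrite ler_wpM2r// lerDl.
rewrite -ltr_pdivlMl//.
by near: t; apply: cvgr_dist_lt; [exact: cvg_id|rewrite mulr_gt0// invr_gt0].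
Unshelve. all: by end_near. Qed.

Let G x := F x + K * x.

Let G_nd : {homo G : x y / x <= y}.
Proof.
move=> x y xy; have := FK x y; 
rewrite distrC [`|x - y|]distrC [`|y - x|]ger0_norm ?subr_ge0//.
by rewrite /G ler_norml => /andP[]; lra.
Qed.

Let G_rc : right_continuous G.
Proof.
apply: right_continuousW => x; apply: cvgD; first exact: lipschitz_real_continuous.
by apply: cvgM; [exact: cvg_cst|exact: cvg_id].
Qed.

HB.instance Definition _ := isCumulative.Build R _ R G G_nd G_rc.

Let nu := lebesgue_stieltjes_measure G.

Let nu_itv a b : a <= b -> nu `]a, b]%classic = (G b - G a)%:E.
Proof.
move=> ab; rewrite /nu /lebesgue_stieltjes_measure /measure_extension.
rewrite measurable_mu_extE; last exact: is_ocitv.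
exact: (wlength_itv_bnd G false false ab).
Qed.

(** Both summands of [G] have slope at most [K], whence the factor 2. *)
Let wlength_G_le A : ocitv A -> (wlength G A <= (2 * K)%:E * wlength idfun A)%E.
Proof.
move=> /ocitvP[->|[[a b] /= ab ->]]; first by rewrite !wlength0 mule0.
rewrite (wlength_itv_bnd G false false (ltW ab)).
rewrite (wlength_itv_bnd idfun false false (ltW ab)) -EFinM lee_fin /G /=.
have := FK b a; rewrite [`|b - a|]gtr0_norm ?subr_gt0// ler_norml => /andP[_].
lra.
Qed.

(** Absolute continuity, as Radon-Nikodym requires. Both measures come from covers by half-open
    intervals, so a cover of [A] of small total length also has small total increment of [G]. *)
Let nu_null A : mu A = 0%E -> nu A = 0%E.
Proof.
move=> muA0; apply/eqP; rewrite eq_le measure_ge0 andbT.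
apply/lee_addgt0Pr => e e0; rewrite add0e.
have K1 : 0 < 2 * K + 1 by rewrite ltr_wpDl// mulr_ge0.
have eK : 0 < e / (2 * K + 1) by rewrite divr_gt0.
have : mu A \is a fin_num by rewrite muA0.
rewrite /lebesgue_measure /lebesgue_stieltjes_measure /measure_extension /mu_ext.
move/lb_ereal_inf_adherent => /(_ _ eK) [_ [I [mI AI] <-]].
rewrite -/(mu_ext _ _) -/(measure_extension _ _) -/(lebesgue_stieltjes_measure idfun A).
rewrite -[lebesgue_stieltjes_measure _ _]/(mu A) muA0 add0e => Ie.
apply: (@le_trans _ _ (\sum_(k <oo) wlength G (I k))%E).
  by apply: ereal_inf_lbound; exists I.
apply: (@le_trans _ _ ((2 * K)%:E * (e / (2 * K + 1))%:E)%E); last first.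
  rewrite -EFinM lee_fin mulrA ler_pdivrMr// [2 * K * e]mulrC ler_pM2l//.
  by rewrite lerDl.
apply: le_trans (lee_wpmul2l _ (ltW Ie)); last by rewrite lee_fin mulr_ge0.
rewrite -nneseriesZl//.
apply: lee_nneseries => [i _ _|i _]; last exact: wlength_G_le (mI i).
exact: (measure_ge0 (wlength G) (I i)).
Qed.

(* The density is the Radon-Nikodym derivative of the Lebesgue-Stieltjes
   measure of the nondecreasing function [F x + K * x], minus [K]. *)
Lemma lipschitz_FTC a b : a < b -> exists g : R -> R,
  [/\ mu.-integrable `[a, b] (EFin \o g),
      forall x, x \in `[a, b] -> F x - F a = \int[mu]_(t in `]a, x]) g t &
      {ae mu, forall x, x \in `]a, b[ -> is_derive x 1 F (g x)}].
Proof.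
move=> ab.
have mD : measurable (`]a, b]%classic : set (measurableTypeR R)).
  exact: measurable_itv.
have nuD : (nu `]a, b]%classic < +oo)%E by rewrite nu_itv ?ltry// ltW.
pose nuab : {finite_measure set (measurableTypeR R) -> \bar R} := mfrestr mD nuD.
have dom : nuab `<< mu.
  move=> N N0 A mA AN; rewrite /nuab /= /mfrestr /mrestr.
  apply/eqP; rewrite eq_le measure_ge0 andbT -(nu_null (N0 _ mA AN)).
  by rewrite le_measure ?inE//; exact: measurableI.
have [f [f0 ffin intf nuf]] := radon_nikodym_sigma_finite dom.
pose h x := fine (f x).
have hE : EFin \o h = f by apply/funext => x; rewrite /h/= fineK.
have inth : mu.-integrable setT (EFin \o h) by rewrite hE.
have Gh x : x \in `[a, b] -> G x - G a = \int[mu]_(t in `]a, x]) h t.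
  rewrite in_itv/= => /andP[ax xb]; apply: EFin_inj.
  rewrite /Rintegral fineK; last first.
    by apply: integrable_fin_num => //; exact: integrableS inth.
  rewrite -nu_itv//; transitivity (nuab `]a, x]%classic).
    rewrite /nuab/= /mfrestr /mrestr; congr (nu _).
    apply/seteqP; split => [t /=|t [] //]; rewrite !in_itv/= => /andP[at_ tx].
    by rewrite at_ tx (le_trans tx).
  by rewrite nuf//; apply: eq_integral => t _; rewrite -hE.
have intK (i : bool) x :
    mu.-integrable [set` Interval (BSide i a) (BRight x)] (EFin \o cst K).
  apply: (@le_integrable_bounded _ _ _ _ _ _ `|K|) => //.
  exact: lebesgue_measure_itv_lty.
have inth' (i : bool) x :
    mu.-integrable [set` Interval (BSide i a) (BRight x)] (EFin \o h).
  exact: integrableS inth.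
exists (fun t => h t - K); split.
- rewrite (_ : EFin \o _ = (EFin \o h) \- (EFin \o cst K))%E.
    by apply: integrableB.
  by apply/funext => t; rewrite /= EFinB.
- move=> x xab; rewrite RintegralB// -Gh// Rintegral_cst//.
  rewrite [fine _](_ : _ = x - a); first by rewrite /G; ring.
  by apply: fine_lebesgue_measure_itv; move: xab; rewrite in_itv/= => /andP[].
- have loch : locally_integrable [set: R] h.
    by apply: open_integrable_locally => //; exact: openT.
  (* Almost everywhere the primitive [H] of [h] has derivative [h]; on [[a, b]] one has
     [F y = H y + G a - K * y]. *)
  have := @FTC1 R h (BRight a) (inth' false) loch.
  apply: filterS; first exact: (ae_filter_ringOfSetsType mu).
  move=> x /= + xab.
  have [ax xb] : a < x /\ x < b by move: xab; rewrite in_itv/= => /andP[].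
  move=> /(_ ax).
  set H := fun y : R => _; case => dH Hx.
  have dH' : is_derive x 1 H (h x).
    by apply: DeriveDef; [exact: dH|rewrite -derive1E; exact: Hx].
  have dF : is_derive x 1 (fun y => H y + G a - K * y) (h x - K).
    by apply: is_derive_eq; rewrite addr0 /GRing.scale/= mulr1.
  apply: near_eq_is_derive dF.
  near=> y; have yab : y \in `[a, b].
    by apply: subset_itv_oo_cc; near: y; exact: near_in_itvoo.
  by rewrite /H -Gh// /G; ring.
Unshelve. all: by end_near. Qed.


End LipschitzFTC.

(** * Changing an integrand on a null set *)

Section NullSetModification.
Context d (T : measurableType d) (R : realType).
Variable mu : {measure set T -> \bar R}.
Import HBNNSimple.

(* The functions are not assumed to be measurable: their integrals are suprema
   over simple functions, which can be cut off on [N]. *)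
Let ge0_le_integral_off_null (N : set T) (f g : T -> \bar R) :
  measurable N -> mu N = 0%E ->
  (forall x, 0 <= f x)%E -> (forall x, 0 <= g x)%E ->
  (forall x, ~ N x -> f x = g x) ->
  (\int[mu]_x f x <= \int[mu]_x g x)%E.
Proof.
move=> mN N0 f0 g0 fg; rewrite ge0_integralTE// [leRHS]ge0_integralTE//.
apply: ge_ereal_sup => _ [h /= hf <-].
have mNC : measurable (~` N) by exact: measurableC.
apply: ereal_sup_ubound; exists (proj_nnsfun h mNC) => /=.
  move=> x; rewrite mindicE; case: (boolP (x \in ~` N)) => xN.
    by rewrite mulr1 -fg ?hf//; move: xN; rewrite inE.
  by rewrite mulr0.
rewrite -!integralT_nnsfun; apply: ge0_ae_eq_integral => //.
- exact/measurable_EFinP.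
- exact/measurable_EFinP.
- by move=> x _; rewrite lee_fin mulr_ge0.
- by move=> x _; rewrite lee_fin.
- exists N; split => // x /= /not_implyP[_]; apply: contra_notP => Nx.
  by rewrite mindicE mem_set// mulr1.
Qed.

(** It allows [speed c], of which no measurability is assumed, to be replaced under the integral by
    a density equal to it off a null set. *)
Lemma integral_off_null (N D : set T) (f g : T -> \bar R) :
  measurable N -> mu N = 0%E ->
  (forall x, D x -> ~ N x -> f x = g x) ->
  (\int[mu]_(x in D) f x = \int[mu]_(x in D) g x)%E.
Proof.
move=> mN N0 fg; rewrite integral_mkcond [RHS]integral_mkcond.
have {}fg x : ~ N x -> (f \_ D) x = (g \_ D) x.
  by move=> Nx; rewrite !patchE; case: ifPn => //; rewrite inE => /fg; exact.
rewrite integralE [RHS]integralE; congr (_ - _)%E;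
  apply/eqP; rewrite eq_le; apply/andP; split;
  apply: (ge0_le_integral_off_null mN N0) => //= x Nx;
  by rewrite ?funeposE ?funenegE fg.
Qed.

Lemma Rintegral_off_null (N D : set T) (f g : T -> R) :
  measurable N -> mu N = 0%E ->
  (forall x, D x -> ~ N x -> f x = g x) ->
  \int[mu]_(x in D) f x = \int[mu]_(x in D) g x.
Proof.
move=> mN N0 fg; congr fine; apply: (integral_off_null mN N0) => x Dx Nx.
by rewrite fg.
Qed.

End NullSetModification.

(** * Division of a curve into arcs of equal length *)

Section ArclengthSampling.
Context {R : realType}.
Notation mu := (@lebesgue_measure R).
Variables (T : R) (w : R -> R).
Hypothesis T0 : 0 < T.
Hypothesis w_ge0 : forall x, 0 <= w x.
Hypothesis w_int : mu.-integrable `[0, T] (EFin \o w).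

Definition arclength t := \int[mu]_(x in `[0, t]) w x.

Lemma integrable_suboc (f : R -> R) a b : 0 <= a -> b <= T ->
  mu.-integrable `[0, T] (EFin \o f) -> mu.-integrable `]a, b] (EFin \o f).
Proof.
move=> a0 bT; apply: integrableS => //.
by apply: subset_itv; rewrite bnd_simp.
Qed.

Lemma Rintegral_ocB (f : R -> R) a b : 0 <= a -> a <= b -> b <= T ->
  mu.-integrable `[0, T] (EFin \o f) ->
  \int[mu]_(x in `[0, b]) f x - \int[mu]_(x in `[0, a]) f x =
  \int[mu]_(x in `]a, b]) f x.
Proof.
move=> a0 ab bT fi; apply: Rintegral_itvB; rewrite ?bnd_simp//.
by apply: integrableS fi => //; apply: subset_itv; rewrite bnd_simp.
Qed.

Lemma arclengthB a b : 0 <= a -> a <= b -> b <= T ->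
  arclength b - arclength a = \int[mu]_(x in `]a, b]) w x.
Proof. by move=> a0 ab bT; rewrite /arclength Rintegral_ocB. Qed.

Lemma arclength_le a b : 0 <= a -> a <= b -> b <= T -> arclength a <= arclength b.
Proof.
by move=> a0 ab bT; rewrite -subr_ge0 arclengthB//; apply: Rintegral_ge0.
Qed.

Lemma arclength0 : arclength 0 = 0.
Proof. by rewrite /arclength set_itv1 Rintegral_set1. Qed.

Lemma arclength_continuous : {within `[0, T], continuous arclength}.
Proof.
by apply: parameterized_integral_continuous => //; exact: ltW.
Qed.

(** The division points come from the intermediate value theorem; they are ordered because their
    arclengths increase strictly while [arclength] is monotone. *)
Lemma arclength_subdivision N : (0 < N)%N -> 0 < arclength T -> exists t : nat -> R,
  [/\ t 0%N = 0, t N = T, forall j, 0 <= t j <= T,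
      forall j, (j < N)%N -> t j <= t j.+1 &
      forall j, (j <= N)%N -> arclength (t j) = arclength T / N%:R * j%:R].
Proof.
move=> N0; set L := arclength T => L0'.
have N0' : (0 : R) < N%:R by rewrite ltr0n.
have L0 := ltW L0'.
(* The last two clauses pin the end points, since a given arclength may be attained at several
   parameters; indices beyond [N] are sent to [T]. *)
have ivt j : exists x, [/\ 0 <= x <= T, (j <= N)%N -> arclength x = L / N%:R * j%:R,
    j = 0%N -> x = 0 & (N <= j)%N -> x = T].
  have [->|j0] := eqVneq j 0%N.
    by exists 0; rewrite lexx ltW//; split=> //; rewrite ?arclength0 ?mulr0//; lia.
  have [Nj|jN] := leqP N j.
    exists T; rewrite lexx ltW//; split=> // [jN|]; last by lia.
    by rewrite (_ : j = N) ?divfK ?gt_eqF//; lia.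
  have [||x xT sx] := @IVT R arclength 0 T (L / N%:R * j%:R) (ltW T0).
  - exact: arclength_continuous.
  - rewrite arclength0 -/L minEle maxEle L0 mulr_ge0 ?divr_ge0// mulrAC.
    by rewrite ler_pdivrMr//= ler_wpM2l// ler_nat ltnW.
  by exists x; split => // h; exfalso; move: j0 jN h; lia.
have [t tP] := choice ivt; exists t; split.
- by have [_ _ + _] := tP 0%N; exact.
- by have [_ _ _ +] := tP N; exact.
- by move=> j; have [+ _ _ _] := tP j.
- move=> j jN; have [/andP[tj0 tjT] sj _ _] := tP j.
  have [/andP[tj0' tjT'] sj' _ t'N] := tP j.+1.
  have [Nj|jN'] := leqP N j.+1; first by rewrite t'N.
  rewrite leNgt; apply/negP => /ltW /(fun h => arclength_le tj0' h tjT).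
  rewrite sj'// sj//; last exact: ltnW.
  by rewrite ler_pM2l ?divr_gt0// ler_nat ltnn.
- by move=> j jN; have [_ + _ _] := tP j; exact.
Qed.

(** On each of the [N] arcs, of length L / N, [f] differs from its value at the left end by at most
    C L / N. Each arc thus contributes an error of at most C (L / N)^2. *)
Lemma arclength_riemann_sum (f : R -> R) (C : R) N (t : nat -> R) : (0 < N)%N ->
  0 <= C -> t 0%N = 0 -> t N = T -> (forall j, 0 <= t j <= T) ->
  (forall j, (j < N)%N -> t j <= t j.+1) ->
  (forall j, (j <= N)%N -> arclength (t j) = arclength T / N%:R * j%:R) ->
  mu.-integrable `[0, T] (EFin \o (fun x => f x * w x)) ->
  (forall a x, 0 <= a -> a <= x -> x <= T ->
    `|f x - f a| <= C * (arclength x - arclength a)) ->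
  `|\int[mu]_(x in `[0, T]) (f x * w x) - arclength T / N%:R * \sum_(j < N) f (t j)|
    <= C * arclength T ^+ 2 / N%:R.
Proof.
move=> N0 C0 t0 tN tT t_nd st fwi fC; set L := arclength T.
have N0' : (0 : R) < N%:R by rewrite ltr0n.
pose H x := \int[mu]_(y in `[0, x]) (f y * w y).
have HN : H T = \sum_(j < N) (H (t j.+1) - H (t j)).
  rewrite -(big_mkord xpredT (fun j => H (t j.+1) - H (t j))) telescope_sumr//.
  by rewrite tN t0 [X in _ = _ - X](_ : _ = 0) ?subr0// /H set_itv1 Rintegral_set1.
rewrite -/(H T) HN mulr_sumr -sumrB.
apply: le_trans (ler_norm_sum _ _ _) _.
have -> : C * L ^+ 2 / N%:R = \sum_(j < N) (C * (L / N%:R) ^+ 2).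
  by rewrite sumr_const card_ord -[RHS]mulr_natr; field; rewrite gt_eqF.
apply: ler_sum => -[j jN] _ /=.
have [/andP[a0 aT] /andP[b0 bT]] := (tT j, tT j.+1).
have ab := t_nd _ jN; set a := t j in a0 aT ab *; set b := t j.+1 in b0 bT ab *.
have sab : arclength b - arclength a = L / N%:R.
  by rewrite /a /b !st//; [rewrite -/L -natr1; ring|exact: ltnW].
have wi' := integrable_suboc a0 bT w_int.
have fwi' := integrable_suboc a0 bT fwi.
have cwi c : mu.-integrable `]a, b] (EFin \o (fun x => c * w x)).
  by under [X in _.-integrable _ X]eq_fun do rewrite /= EFinM; exact: integrableZl.
have dwi : mu.-integrable `]a, b] (EFin \o (fun x => f x * w x - f a * w x)).
  under [X in _.-integrable _ X]eq_fun do rewrite /= EFinB.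
  exact: integrableB (cwi _).
rewrite /H Rintegral_ocB// -{1}sab arclengthB// mulrC -RintegralZl// -RintegralB//.
apply: le_trans (le_normr_Rintegral _ _) _ => //.
rewrite expr2 [C * _]mulrA -{2}sab arclengthB// -RintegralZl//.
apply: le_Rintegral => //; first exact: integrable_norm.
move=> x; rewrite /= in_itv/= => /andP[ax xb].
rewrite -mulrBl normrM [`|w x|]ger0_norm// ler_wpM2r//.
rewrite (le_trans (fC a x a0 (ltW ax) (le_trans xb bT)))// ler_wpM2l// -sab lerD2r.
by apply: arclength_le => //; exact: le_trans (ltW ax).
Qed.


End ArclengthSampling.

(** * Lipschitz closure of a curve and its derivative almost everywhere *)

Section CloseUp.
Context {R : realType} {d : nat}.
Notation mu := (@lebesgue_measure R).
Implicit Types c : R -> 'rV[R]_d.+1.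

(* Off [0, 2 * pi[ the curve is replaced by c 0, its left limit at 2 * pi, which
   makes it Lipschitz on the whole line. *)
Definition close_up c (t : R) := if t \in `[0, 2 * pi[ then c t else c 0.

Lemma twopi_gt0 : 0 < 2 * pi :> R. Proof. by rewrite mulr_gt0 ?pi_gt0. Qed.

Lemma close_up0 c : close_up c 0 = c 0.
Proof. by rewrite /close_up in_itv/= lexx twopi_gt0. Qed.

Lemma close_up_end c : close_up c (2 * pi) = c 0.
Proof. by rewrite /close_up in_itv/= ltxx andbF. Qed.

Lemma le_coord_norm n (x : 'rV[R]_n) i : `|x 0 i| <= `|x|.
Proof.
rewrite {2}/Num.norm/= mx_normrE.
exact: (le_bigmax _ (fun i => `|x i.1 i.2|) (0, i)).
Qed.

Lemma close_up_lipschitz c : closed_lipschitz_curve c ->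
  exists K : R, forall i x y,
    `|close_up c x 0 i - close_up c y 0 i| <= K * `|x - y|.
Proof.
(* The Lipschitz bound is available for constants strictly above [M], which may be negative. *)
move=> [_ [M [_ MP]] cend]; pose K := Num.max M 0 + 1.
have MK : M < K by rewrite (@le_lt_trans _ _ (Num.max M 0)) ?le_max ?lexx// ltrDl.
have K0 : 0 <= K by rewrite addr_ge0// le_max lexx orbT.
have cK x y : x \in `[0, 2 * pi[ -> y \in `[0, 2 * pi[ -> `|c x - c y| <= K * `|x - y|.
  by move=> xI yI; have := MP _ MK (x, y); apply.
have I0 : (0 : R) \in `[0, 2 * pi[ by rewrite in_itv/= lexx twopi_gt0.
(* Compare [c x] with [c y] and let [y] tend to [2 * pi] from the left, where [c y] tends to
   [c 0]. *)
have cKend x : x \in `[0, 2 * pi[ -> `|c x - c 0| <= K * (2 * pi - x).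
  move=> xI; have := xI; rewrite in_itv/= => /andP[x0 xpi].
  apply/ler_addgt0Pr => e e0.
  near (2 * pi : R)^'- => y.
  have xy : x < y by near: y; exact: nbhs_left_gt.
  have ypi : y < 2 * pi by near: y; exact: nbhs_left_lt.
  have cy0 : `|c 0 - c y| < e by near: y; exact: cvgr_dist_lt.
  have yI : y \in `[0, 2 * pi[ by rewrite in_itv/= ypi (le_trans x0 (ltW xy)).
  rewrite (le_trans (ler_distD (c y) _ _))// lerD//; last by rewrite distrC ltW.
  rewrite (le_trans (cK _ _ xI yI))// ler_wpM2l// distrC gtr0_norm ?subr_gt0//.
  by rewrite lerD2r ltW.
suff H x y : `|close_up c x - close_up c y| <= K * `|x - y|.
  exists K => i x y; rewrite (le_trans _ (H x y))//.
  by have := le_coord_norm (close_up c x - close_up c y) i; rewrite !mxE.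
wlog xI : x y / x \in `[0, 2 * pi[ => [hw|].
  have [xI|xI] := boolP (x \in `[0, 2 * pi[); first exact: hw.
  have [yI|yI] := boolP (y \in `[0, 2 * pi[).
    by rewrite distrC [in leRHS]distrC; exact: hw.
  by rewrite /close_up (negbTE xI) (negbTE yI) subrr normr0 mulr_ge0.
rewrite /close_up xI; case: ifPn => yI; first exact: cK.
have := xI; rewrite in_itv/= => /andP[x0 xpi].
move: yI; rewrite in_itv/= negb_and -ltNge -leNgt => /orP[y0|ypi].
  rewrite (le_trans (cK _ _ xI I0))// ler_wpM2l// subr0 ger0_norm//.
  by rewrite ger0_norm; lra.
rewrite (le_trans (cKend _ xI))// ler_wpM2l// distrC ger0_norm; lra.
Unshelve. all: by end_near. Qed.

Lemma close_up_derivative c : closed_lipschitz_curve c ->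
  exists (g : 'I_d.+1 -> R -> R) (N : set (measurableTypeR R)),
  [/\ forall i, mu.-integrable `[0, 2 * pi] (EFin \o g i),
      forall i x, x \in `[0, 2 * pi] ->
        close_up c x 0 i - c 0 0 i = \int[mu]_(t in `]0, x]) g i t,
      measurable N, mu N = 0%E &
      forall t, t \in `[0, 2 * pi[ -> ~ N t -> derive1 c t = \row_i g i t].
Proof.
move=> cc; have [K cK] := close_up_lipschitz cc.
have /choice[g gP] : forall i, exists g : R -> R,
   [/\ mu.-integrable `[0, 2 * pi] (EFin \o g),
      forall x, x \in `[0, 2 * pi] ->
        close_up c x 0 i - c 0 0 i = \int[mu]_(t in `]0, x]) g t &
      {ae mu, forall x, x \in `]0, 2 * pi[ ->
        is_derive x 1 (fun t => close_up c t 0 i) (g x)}].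
  move=> i; have [g [g1 g2 g3]] := lipschitz_FTC (cK i) twopi_gt0.
  by exists g; split => //; rewrite -close_up0.
have : {ae mu, forall x, x \in `]0, 2 * pi[ -> forall i,
        is_derive x 1 (fun t => close_up c t 0 i) (g i x)}.
  have gae i : {ae mu, forall x, x \in `]0, 2 * pi[ ->
      is_derive x 1 (fun t => close_up c t 0 i) (g i x)} by have [] := gP i.
  have F := ae_filter_ringOfSetsType mu.
  have := filter_forall F gae.
  by apply: filterS => x /= h xI i; exact: h.
move=> [N [mN N0 NP]].
have m0 : measurable ([set 0] : set (measurableTypeR R)) by exact: measurable_set1.
(* The point 0 joins the null set: [derive1 c 0] is two-sided and sees values of [c] outside [[0, 2
   * pi[]. *)
exists g, (N `|` [set 0]); split.
- by move=> i; have [] := gP i.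
- by move=> i; have [] := gP i.
- exact: measurableU.
- apply/eqP; rewrite -measure_le0 (le_trans (measureU2 _ mN m0))//.
  rewrite -[0%E in leRHS]adde0 leeD//; first by rewrite [leLHS]N0.
  by rewrite [leLHS]lebesgue_measure_set1.
move=> t tI /= tN.
have t0 : t \in `]0, 2 * pi[.
  move: tI; rewrite !in_itv/= => /andP[]; rewrite le_eqVlt => /predU1P[t0|->//].
  by case: tN; right.
have {}tN : ~ N t by move=> Nt; apply: tN; left.
have dt i : is_derive t 1 (fun t => close_up c t 0 i) (g i t).
  move: tN; apply: contra_notP => nd; apply: NP => /= h; exact/nd/(h t0 i).
have dc : derivable (close_up c) t 1 by apply/derivable_mxP => j i; rewrite ord1.
have cc' : \forall x \near t, close_up c x = c x.
  near=> x; have xI : x \in `]0, 2 * pi[ by near: x; exact: near_in_itvoo.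
  by rewrite /close_up subset_itv_oo_co.
rewrite derive1E -(near_eq_derive (1 : R) cc') derive_mx//.
by apply/rowP => i; rewrite !mxE; exact: derive_val.
Unshelve. all: by end_near. Qed.

End CloseUp.

Lemma integrable_sum_EFin d (T : measurableType d) (R : realType)
    (mu : {measure set T -> \bar R}) (D : set T) (I : Type) (s : seq I)
    (f : I -> T -> R) : measurable D ->
  (forall i, mu.-integrable D (EFin \o f i)) ->
  mu.-integrable D (EFin \o (fun x => \sum_(i <- s) f i x)).
Proof.
move=> mD fi; elim: s => [|i s ih].
  by under [X in _.-integrable _ X]eq_fun do rewrite /= big_nil; exact: integrable0.
under [X in _.-integrable _ X]eq_fun do rewrite /= big_cons EFinD.
exact: (integrableD mD (fi i) ih).
Qed.

Lemma Rintegral_sum d (T : measurableType d) (R : realType)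
    (mu : {measure set T -> \bar R}) (D : set T) (I : Type) (s : seq I)
    (f : I -> T -> R) : measurable D ->
  (forall i, mu.-integrable D (EFin \o f i)) ->
  \int[mu]_(x in D) (\sum_(i <- s) f i x) = \sum_(i <- s) \int[mu]_(x in D) f i x.
Proof.
move=> mD fi; elim: s => [|i s ih].
  under eq_Rintegral do rewrite big_nil.
  by rewrite Rintegral_cst// mul0r big_nil.
under eq_Rintegral do rewrite big_cons.
by rewrite RintegralD ?ih ?big_cons//; exact: integrable_sum_EFin.
Qed.

Lemma eucl_normE (R : realType) n (x : 'rV[R]_n) :
  eucl_norm x ^+ 2 = \sum_i x 0 i ^+ 2.
Proof. by rewrite sqr_sqrtr// sumr_ge0// => i _; exact: sqr_ge0. Qed.

Lemma eucl_norm_ge0 (R : realType) n (x : 'rV[R]_n) : 0 <= eucl_norm x.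
Proof. exact: sqrtr_ge0. Qed.

(** With X and Y the two norms, |Y x - X y|^2 = 2 X Y (X Y - <x, y>); if X Y = 0, one of the vectors
    vanishes. *)
Lemma eucl_cauchy_schwarz (R : realType) n (x y : 'rV[R]_n) :
  \sum_i x 0 i * y 0 i <= eucl_norm x * eucl_norm y.
Proof.
set X := eucl_norm x; set Y := eucl_norm y.
have [X0 Y0] : 0 <= X /\ 0 <= Y by split; exact: eucl_norm_ge0.
have : 0 <= \sum_i (Y * x 0 i - X * y 0 i) ^+ 2.
  by apply: sumr_ge0 => i _; exact: sqr_ge0.
have -> : \sum_i (Y * x 0 i - X * y 0 i) ^+ 2 =
    2 * (X * Y) * (X * Y - \sum_i x 0 i * y 0 i).
  have XE : X ^+ 2 = _ := eucl_normE x; have YE : Y ^+ 2 = _ := eucl_normE y.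
  transitivity (Y ^+ 2 * X ^+ 2 - 2 * (X * Y) * (\sum_i x 0 i * y 0 i)
                + X ^+ 2 * Y ^+ 2).
    rewrite {1}XE {2}YE !mulr_sumr -sumrB -big_split.
    by apply: eq_bigr => i _ /=; ring.
  by ring.
have [XY0 _|XY0] := eqVneq (X * Y) 0; last first.
  rewrite pmulr_rge0; first by rewrite subr_ge0.
  by rewrite mulr_gt0// lt_neqAle eq_sym XY0 mulr_ge0.
have zero (z : 'rV[R]_n) i : eucl_norm z = 0 -> z 0 i = 0.
  move=> z0; have := eucl_normE z; rewrite z0 expr0n/= => /esym/eqP.
  rewrite psumr_eq0; last by move=> j _; exact: sqr_ge0.
  by move=> /allP /(_ i); rewrite mem_index_enum sqrf_eq0 => /(_ isT)/eqP.
rewrite XY0 big1// => i _; move/eqP: XY0; rewrite mulf_eq0 => /orP[] /eqP /zero ->.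
  by rewrite mul0r.
by rewrite mulr0.
Qed.

Lemma le_coord_eucl (R : realType) n (x : 'rV[R]_n) i : `|x 0 i| <= eucl_norm x.
Proof.
rewrite -(@ler_pXn2r _ 2)// ?nnegrE ?eucl_norm_ge0// eucl_normE.
rewrite real_normK ?num_real// (bigD1 i)//= lerDl.
by apply: sumr_ge0 => j _; exact: sqr_ge0.
Qed.

(** * Integrable speed density and chord lengths *)

Section CurveSpeed.
Context {R : realType} {d : nat}.
Notation mu := (@lebesgue_measure R).
Implicit Types c : R -> 'rV[R]_d.+1.

Lemma integrable_eucl_norm n (D : set R) (g : 'I_n -> R -> R) :
  measurable D -> (forall i, mu.-integrable D (EFin \o g i)) ->
  mu.-integrable D (EFin \o (fun t => eucl_norm (\row_i g i t))).
Proof.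
move=> mD gi.
have mg i : measurable_fun (D : set (measurableTypeR R)) (g i : measurableTypeR R -> R).
  by apply/measurable_EFinP; exact: measurable_int (gi i).
apply: (@le_integrable _ _ _ mu _ mD _ (EFin \o (fun t => \sum_i `|g i t|))).
- apply/measurable_EFinP; apply: measurableT_comp.
    by apply: continuous_measurable_fun; exact: sqrt_continuous.
  under eq_fun do under eq_bigr do rewrite mxE.
  by apply: measurable_sum => i; exact: measurable_funX.
- move=> t _; rewrite /= lee_fin ger0_norm ?eucl_norm_ge0// ger0_norm ?sumr_ge0//.
  rewrite -(@ler_pXn2r _ 2)// ?nnegrE ?eucl_norm_ge0 ?sumr_ge0// eucl_normE.
  rewrite expr2 mulr_suml; apply: ler_sum => i _.
  rewrite mxE -[leLHS]real_normK ?num_real// expr2 ler_wpM2l//.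
  by rewrite (bigD1 i)//= lerDl sumr_ge0.
- by apply: integrable_sum_EFin => // i; exact: integrable_norm.
Qed.

Lemma speed_density c : closed_lipschitz_curve c -> exists w : R -> R,
  [/\ forall t, 0 <= w t, mu.-integrable `[0, 2 * pi] (EFin \o w),
      forall F : R -> R, mu.-integrable `[0, 2 * pi] (EFin \o (fun t => F t * w t)) ->
        \int[mu]_(t in `[0, 2 * pi[) (F t * speed c t) =
        \int[mu]_(t in `[0, 2 * pi]) (F t * w t) &
      forall a b, 0 <= a -> a <= b -> b <= 2 * pi ->
        eucl_norm (close_up c b - close_up c a) <= arclength w b - arclength w a].
Proof.
move=> cc; have [g [N [gi cg mN N0 gN]]] := close_up_derivative cc.
pose w t := eucl_norm (\row_i g i t).
have w0 t : 0 <= w t by exact: eucl_norm_ge0.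
have wi : mu.-integrable `[0, 2 * pi] (EFin \o w) by exact: integrable_eucl_norm.
exists w; split => //.
- move=> F Fwi; rewrite -Rintegral_itv_bndo_bndc; last first.
    by apply: integrableS Fwi => //; exact: subset_itv_co_cc.
  by apply: (Rintegral_off_null mN N0) => t tI tN; rewrite /speed gN.
- move=> a b a0 ab bpi; set v := close_up c b - close_up c a; set V := eucl_norm v.
  have gab i : mu.-integrable `]a, b] (EFin \o g i) by exact: integrable_suboc (gi i).
  have wab := integrable_suboc a0 bpi wi.
  have vE i : v 0 i = \int[mu]_(t in `]a, b]) g i t.
    rewrite -(@Rintegral_itvB _ (g i) (BRight 0) (BRight b) a) ?bnd_simp//; last first.
      exact: integrable_suboc (gi i).
    rewrite -!cg ?in_itv/= ?a0 ?(le_trans a0 ab) ?(le_trans ab bpi)//.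
    by rewrite /v !mxE; ring.
  (* [V * V] is the integral of the scalar product of [v] with the density [g], which Cauchy-Schwarz
     bounds by [V * w]; dividing by [V] gives the chord bound. *)
  have VV : V * V <= V * (arclength w b - arclength w a).
    rewrite -expr2 eucl_normE (arclengthB wi)// -RintegralZl//.
    under eq_bigr do rewrite expr2 {2}vE -RintegralZl//.
    have vgi i : mu.-integrable `]a, b] (EFin \o (fun t => v 0 i * g i t)).
      under [X in _.-integrable _ X]eq_fun do rewrite /= EFinM.
      by apply: integrableZl => //; exact: gab.
    rewrite -Rintegral_sum//; apply: le_Rintegral => //.
    + exact: integrable_sum_EFin.
    + under [X in _.-integrable _ X]eq_fun do rewrite /= EFinM.
      exact: integrableZl.
    + move=> t _; apply: le_trans (eucl_cauchy_schwarz v (\row_i g i t)).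
      by rewrite le_eqVlt; apply/orP; left; apply/eqP/eq_bigr => i _; rewrite mxE.
  have [V0|V0] := eqVneq V 0.
    by rewrite V0 subr_ge0 (arclength_le _ wi).
  by rewrite ler_pM2l// in VV; rewrite lt_neqAle eq_sym V0 eucl_norm_ge0.
Qed.

End CurveSpeed.

(** * Length of a spherical curve with isotropic moments *)

Section CurveLowerBound.
Context {R : realType} {d : nat}.
Notation mu := (@lebesgue_measure R).
Variables (k : nat) (c : R -> 'rV[R]_d.+1).
Hypothesis dk : d.+1 = (2 * k)%N.
Hypothesis cc : closed_lipschitz_curve c.

Lemma close_up_sphere t : eucl_norm (close_up c t) = 1.
Proof.
have [cS _ _] := cc; rewrite /close_up; case: ifPn => [|_]; first exact: cS.
by apply: cS; rewrite in_itv/= lexx twopi_gt0.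
Qed.

Lemma close_up_coord_le1 t i : `|close_up c t 0 i| <= 1.
Proof. by rewrite -(close_up_sphere t) le_coord_eucl. Qed.

Lemma isotropic_curve_length_ge : 0 < curve_length c ->
  (forall i, \int[mu]_(t in `[0, 2 * pi[) (c t 0 i * speed c t) = 0) ->
  (forall i l, \int[mu]_(t in `[0, 2 * pi[) (c t 0 i * c t 0 l * speed c t) =
     curve_length c * ((i == l)%:R / d.+1%:R)) ->
  2 * pi * Num.sqrt (A2 R k / B2 R k) <= curve_length c.
Proof.
have k0 : (0 < k)%N by case: k dk.
set L := curve_length c => L0 c1 c2.
have [w [w0 wi wF chord]] := speed_density cc.
have Lw : L = arclength w (2 * pi).
  rewrite /L /curve_length /arclength.
  transitivity (\int[mu]_(t in `[0, 2 * pi[) (1 * speed c t)).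
    by apply: eq_Rintegral => t _; rewrite mul1r.
  rewrite (wF (cst 1)).
    by apply: eq_Rintegral => t _; rewrite mul1r.
  by under [X in _.-integrable _ X]eq_fun do rewrite /= mul1r.
have [K cK] := close_up_lipschitz cc.
pose x (t : R) (i : 'I_d.+1) : R := close_up c t 0 i.
have xm i : measurable_fun setT (fun t : measurableTypeR R => x t i).
  apply: continuous_measurable_fun.
  exact: (@lipschitz_real_continuous _ (fun t => x t i) K (cK i)).
have x1 t i : `|x t i| <= 1 by exact: close_up_coord_le1.
have chord1 a b i : 0 <= a -> a <= b -> b <= 2 * pi ->
    `|x b i - x a i| <= arclength w b - arclength w a.
  move=> a0 ab bpi; rewrite (le_trans _ (chord _ _ a0 ab bpi))//.
  by have := le_coord_eucl (close_up c b - close_up c a) i; rewrite !mxE.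
have Fwi (F : R -> R) : measurable_fun setT (F : measurableTypeR R -> R) ->
    (forall t, `|F t| <= 1) ->
    mu.-integrable `[0, 2 * pi] (EFin \o (fun t => F t * w t)).
  move=> mF F1; apply: (@le_integrable _ _ _ mu `[0, 2 * pi]%classic _ _ _ _ _ wi) => //.
    apply/measurable_EFinP; apply: measurable_funM; first exact: measurable_funS mF.
    by apply/measurable_EFinP; exact: measurable_int wi.
  move=> t _; rewrite /= lee_fin normrM [leRHS]ger0_norm// [`|w t|]ger0_norm//.
  by rewrite -[leRHS]mul1r ler_wpM2r.
suff H : (2 * pi) ^+ 2 * (A2 R k / B2 R k) <= L ^+ 2.
  rewrite -(@ler_pXn2r _ 2)// ?nnegrE ?(ltW L0)//; last first.
    by rewrite mulr_ge0 ?sqrtr_ge0// ltW// twopi_gt0.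
  rewrite exprMn sqr_sqrtr// divr_ge0 ?mulr_ge0 ?sumr_ge0// => m _; exact: sqr_ge0.
apply: (@asymptotic_energy R d.+1) => //; first exact: ltW.
move=> N kN; have N0 : (0 < N)%N by lia.
have N0' : (0 : R) < N%:R by rewrite ltr0n.
have Lw0 : 0 < arclength w (2 * pi) by rewrite -Lw.
have [t [t0 tN tI t_nd st]] := arclength_subdivision twopi_gt0 w0 wi N0 Lw0.
(* The Riemann sum error is at most C L^2 / N; rescaling by N / L turns it into C L, and C <= 2. *)
have riem (F : R -> R) (C v : R) : 0 <= C -> C <= 2 ->
    measurable_fun setT (F : measurableTypeR R -> R) -> (forall t, `|F t| <= 1) ->
    (forall a b, 0 <= a -> a <= b -> b <= 2 * pi ->
      `|F b - F a| <= C * (arclength w b - arclength w a)) ->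
    \int[mu]_(s in `[0, 2 * pi[) (F s * speed c s) = L * v ->
    `|\sum_(j < N) F (t j) - N%:R * v| <= N%:R * (2 * L / N%:R).
  move=> C0 C2 mF F1 FC Fv.
  have := arclength_riemann_sum w0 wi N0 C0 t0 tN tI t_nd st (Fwi F mF F1) FC.
  rewrite -wF ?Fv; last exact: Fwi.
  rewrite -Lw => h.
  have e : L / N%:R * (\sum_(j < N) F (t j) - N%:R * v) =
      - (L * v - L / N%:R * \sum_(j < N) F (t j)) by field; rewrite gt_eqF.
  have LN : 0 < L / N%:R by rewrite divr_gt0.
  rewrite -(ler_pM2l LN) -[X in X * `|_|]gtr0_norm// -normrM e normrN.
  apply: le_trans h _.
  rewrite (_ : L / N%:R * _ = 2 * (L ^+ 2 / N%:R)); last by field; rewrite gt_eqF.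
  by rewrite -mulrA ler_wpM2r// divr_ge0 ?sqr_ge0.
have xint i : \int[mu]_(s in `[0, 2 * pi[) (x s i * speed c s) = 0.
  rewrite -[RHS](c1 i); apply: eq_Rintegral => s; rewrite inE/= => sI.
  by rewrite /x /close_up sI.
exists (fun i j => x (t j) i); split.
- by move=> i; rewrite t0 tN /x close_up_end close_up0.
- by move=> j; rewrite -eucl_normE close_up_sphere expr1n.
(* Coordinates are bounded by 1 and 1-Lipschitz in arclength, so a product of two of them is
   2-Lipschitz. *)
- move=> i l; apply: (riem (fun s => x s i * x s l) 2) => //.
  + exact: measurable_funM.
  + by move=> s; rewrite normrM -[leRHS]mulr1 ler_pM.
  + move=> a b a0 ab bpi.
    have := chord1 a b i a0 ab bpi; have := chord1 a b l a0 ab bpi.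
    set S := _ - _ => hl hi; rewrite mulr2n mulrDl mul1r.
    rewrite (_ : x b i * x b l - x a i * x a l =
      (x b i - x a i) * x b l + x a i * (x b l - x a l)); last by ring.
    rewrite (le_trans (ler_normD _ _))// lerD// normrM.
      by rewrite -[leRHS]mulr1 ler_pM.
    by rewrite -[leRHS]mul1r ler_pM.
  + rewrite -c2; apply: eq_Rintegral => s; rewrite inE/= => sI.
    by rewrite /x /close_up sI.
- move=> i; rewrite -[X in `|X|]subr0 -[X in _ - X](mulr0 N%:R).
  apply: (riem (fun s => x s i) 1) => //.
  + by rewrite ler1n.
  + by move=> a b a0 ab bpi; rewrite mul1r chord1.
  + by rewrite mulr0 xint.
(* Each edge is a chord of an arc of length L / N; the [N] squares add up to at most L^2 / N. *)
- rewrite exchange_big/=.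
  apply: (@le_trans _ _ (\sum_(j < N) (L / N%:R) ^+ 2)); last first.
    rewrite sumr_const card_ord -mulr_natl le_eqVlt; apply/orP; left; apply/eqP.
    by field; rewrite gt_eqF.
  apply: ler_sum => -[j jN] _ /=.
  have [/andP[a0 aT] /andP[b0 bT]] := (tI j, tI j.+1).
  have := chord _ _ a0 (t_nd _ jN) bT; rewrite !st ?(ltnW jN)// -Lw => h.
  rewrite (_ : L / N%:R = L / N%:R * j.+1%:R - L / N%:R * j%:R); last first.
    by rewrite -natr1; ring.
  apply: le_trans (_ : eucl_norm (close_up c (t j.+1) - close_up c (t j)) ^+ 2 <= _).
    rewrite eucl_normE le_eqVlt; apply/orP; left; apply/eqP/eq_bigr => i _.
    by rewrite !mxE.
  rewrite ler_pXn2r// ?nnegrE ?eucl_norm_ge0//.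
  by apply: le_trans h; exact: eucl_norm_ge0.
Qed.

End CurveLowerBound.

(** * Moments of the sphere *)

Section BorelRow.
Context {R : realType}.

Lemma continuous_rowP (T : topologicalType) n (f : T -> 'rV[R]_n) :
  (forall i, continuous (fun x => f x 0 i)) -> continuous f.
Proof.
move=> cf x; apply/cvgrPdist_le => e e0; near=> y.
rewrite /Num.Def.normr/= mx_normrE (bigmax_le _ (ltW e0))//= => -[j i] _.
rewrite ord1 !mxE/=; move: i; near: y; apply: filter_forall => i.
exact: ((cvgrPdist_le _ _).1 (cf i x)).
Unshelve. all: by end_near. Qed.

Lemma continuous_mulmxr n m (M : 'M[R]_(n, m)) :
  continuous (fun x : 'rV[R]_n => x *m M).
Proof.
apply: continuous_rowP => i.
under [X in continuous X]eq_fun do rewrite mxE.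
apply: continuous_big => [|j _ x]; first exact: add_continuous.
have xj := @coord_continuous R 1 n 0 j x.
have Fx : Filter (nbhs x) by exact: nbhs_filter.
exact: (cvgM xj (@cvg_cst R (M j i) _ _ Fx)).
Qed.

Lemma continuous_borel_rV n (f : 'rV[R]_n -> R) : continuous f ->
  measurable_fun setT (f : borel_rV R n -> R).
Proof.
move=> cf; apply: (measurability _ (RGenOInfty.measurableE R)) => //.
move=> _ [_ [x ->] <-]; rewrite setTI; apply: sub_sigma_algebra.
by apply: open_comp => //; exact: interval_open.
Qed.

Lemma measurable_coord n i : measurable_fun setT (fun x : borel_rV R n => x 0 i).
Proof. by apply: continuous_borel_rV; exact: coord_continuous. Qed.

Lemma measurable_mulmxr n m (M : 'M[R]_(n, m)) :
  measurable_fun setT (fun x : borel_rV R n => (x *m M : borel_rV R m)).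
Proof.
apply: (@measurability _ _ (borel_rV R n) (borel_rV R m) setT _ (@open 'rV[R]_m)) => //.
move=> _ [A oA <-].
rewrite setTI; apply: sub_sigma_algebra.
by apply: open_comp => // x _; exact: continuous_mulmxr.
Qed.

Lemma measurable_eucl_norm n : measurable_fun setT (@eucl_norm R n : borel_rV R n -> R).
Proof.
apply: measurableT_comp.
  by apply: continuous_measurable_fun; exact: sqrt_continuous.
by apply: measurable_sum => i; apply: measurable_funX; exact: measurable_coord.
Qed.

Lemma measurable_sphere d : measurable (sphere R d : set (borel_rV R d.+1)).
Proof.
rewrite (_ : sphere R d = setT `&` @eucl_norm R d.+1 @^-1` [set 1]).
  by apply: measurable_eucl_norm => //; exact: measurable_set1.
by rewrite setTI.
Qed.

End BorelRow.

Section QuarterTurn.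
Context {R : comNzRingType} {n : nat}.
Implicit Types i j l : 'I_n.

(** For [i != j], a rotation by a right angle in the plane of coordinates [i] and [j]: the
    transposition and the sign change each have determinant -1. *)
Definition quarter_turn i j : 'M[R]_n :=
  perm_mx (tperm i j) *m diag_mx (\row_l (if l == j then -1 else 1)).

Lemma quarter_turnE i j (x : 'rV[R]_n) l :
  (x *m quarter_turn i j) 0 l =
  x 0 (tperm i j l) * (if l == j then -1 else 1).
Proof.
rewrite /quarter_turn mulmxA.
have -> : x *m perm_mx (tperm i j) = col_perm (tperm i j) x.
  by rewrite col_permE tpermV.
by rewrite mul_mx_diag !mxE.
Qed.

Lemma quarter_turn_orthogonal i j : quarter_turn i j *m (quarter_turn i j)^T = 1%:M.
Proof.
rewrite /quarter_turn trmx_mul tr_diag_mx mulmxA.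
set D := diag_mx _; rewrite -[_ *m D *m D]mulmxA mulmx_diag (_ : diag_mx _ = 1%:M); last first.
  apply/matrixP => a b; rewrite !mxE; congr (_ *+ _).
  by case: ifP => _; rewrite ?mulrNN mulr1.
by rewrite mulmx1 tr_perm_mx -perm_mxM tpermV tperm2 perm_mx1.
Qed.

Lemma det_quarter_turn i j : i != j -> \det (quarter_turn i j) = 1.
Proof.
move=> ij; rewrite /quarter_turn det_mulmx det_perm odd_tperm ij det_diag.
rewrite (bigD1 j)//= mxE eqxx big1 ?mulr1 ?mulrNN ?mulr1// => l lj.
by rewrite mxE (negbTE lj).
Qed.

End QuarterTurn.

Section SphereMoments.
Context {R : realType} {d : nat}.
Variable sigma : probability (borel_rV R d.+1) R.
Hypothesis hsigma : uniform_on_sphere sigma.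

Lemma sphere_coord_le1 (x : 'rV[R]_d.+1) i : sphere R d x -> `|x 0 i| <= 1.
Proof. by rewrite /sphere /= => <-; exact: le_coord_eucl. Qed.

Lemma sphere_integrable (f : borel_rV R d.+1 -> R) (M : R) :
  measurable_fun setT f -> (forall x, sphere R d x -> `|f x| <= M) ->
  sigma.-integrable (sphere R d) (EFin \o f).
Proof.
move=> mf fM; have mS := @measurable_sphere R d.
apply: (@le_integrable_bounded _ _ _ sigma _ _ M) => //.
  by rewrite (le_lt_trans (probability_le1 _ mS))// ltry.
exact: measurable_funS mf.
Qed.

(** Change of variables: the rotation maps the sphere to itself and pushes [sigma] forward to
    [sigma]. *)
Lemma sphere_rotation (M : 'M[R]_d.+1) (f : borel_rV R d.+1 -> R) (C : R) :
  is_rotation M -> measurable_fun setT f ->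
  (forall x, sphere R d x -> `|f x| <= C) ->
  \int[sigma]_(x in sphere R d) f (x *m M) = \int[sigma]_(x in sphere R d) f x.
Proof.
move=> Mrot mf fC; have mS := @measurable_sphere R d.
pose phi (x : borel_rV R d.+1) : borel_rV R d.+1 := x *m M.
have mphi : measurable_fun setT phi by exact: measurable_mulmxr.
have phiS : phi @^-1` (sphere R d) = sphere R d.
  have en x : eucl_norm (x *m M) = eucl_norm x.
    rewrite /eucl_norm; congr Num.sqrt.
    have sq (y : 'rV[R]_d.+1) : \sum_i y 0 i ^+ 2 = (y *m y^T) 0 0.
      by rewrite mxE; apply: eq_bigr => i _; rewrite mxE expr2.
    by rewrite !sq trmx_mul mulmxA -[x *m M *m _]mulmxA Mrot.1 mulmx1.
  by apply/seteqP; split => x; rewrite /phi /sphere /= en.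
congr fine.
have mfE : measurable_fun setT (EFin \o f) by exact/measurable_EFinP.
have fphi : sigma.-integrable (phi @^-1` sphere R d) ((EFin \o f) \o phi).
  rewrite phiS; apply: (@sphere_integrable (f \o phi) C).
    exact: measurableT_comp.
  move=> x Sx; apply: fC.
  by have : (phi @^-1` sphere R d) x by rewrite phiS.
have e := integral_pushforward mphi mfE fphi mS; rewrite phiS in e.
rewrite -[LHS]e.
apply: eq_measure_integral => A mA _; rewrite /pushforward.
by have [_ inv] := hsigma; exact: inv.
Qed.

Lemma measurable_coord2 i j :
  measurable_fun setT (fun x : borel_rV R d.+1 => x 0 i * x 0 j).
Proof. by apply: measurable_funM; exact: measurable_coord. Qed.

Lemma sphere_coord2_le1 (x : 'rV[R]_d.+1) i j : sphere R d x -> `|x 0 i * x 0 j| <= 1.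
Proof. by move=> Sx; rewrite normrM -[leRHS]mulr1 ler_pM// sphere_coord_le1. Qed.

Let turn i j : i != j -> is_rotation (quarter_turn i j : 'M[R]_d.+1).
Proof.
by move=> ij; split; [exact: quarter_turn_orthogonal|exact: det_quarter_turn].
Qed.

Let other (hd : (0 < d)%N) (i : 'I_d.+1) : exists j, i != j.
Proof.
have [->|i0] := eqVneq i ord0; last by exists ord0.
by exists ord_max; rewrite -(inj_eq val_inj)/= eq_sym -lt0n.
Qed.

(** The quarter turn shows that the means of coordinates [i] and [j] are both equal and opposite;
    [0 < d] provides the second coordinate. *)
Lemma sphere_integral_coord i : (0 < d)%N ->
  \int[sigma]_(x in sphere R d) (x 0 i) = 0.
Proof.
move=> /other /(_ i) [j ij]; have mc := @measurable_coord R d.+1.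
have cl l x := @sphere_coord_le1 x l.
have := sphere_rotation (turn ij) (mc i) (cl i).
under eq_Rintegral do rewrite quarter_turnE tpermL (negbTE ij) mulr1.
have := sphere_rotation (turn ij) (mc j) (cl j).
under eq_Rintegral do rewrite quarter_turnE tpermR eqxx.
rewrite RintegralZr; last 2 first.
- exact: measurable_sphere.
- exact: sphere_integrable (mc i) (cl i).
by lra.
Qed.

(** The quarter turn changes the sign of [x 0 i * x 0 j] and exchanges the squares of the two
    coordinates. *)
Let sphere_integral_offdiag i j : i != j ->
  \int[sigma]_(x in sphere R d) (x 0 i * x 0 j) = 0 /\
  \int[sigma]_(x in sphere R d) (x 0 i * x 0 i) =
  \int[sigma]_(x in sphere R d) (x 0 j * x 0 j).
Proof.
move=> ij; have mc := measurable_coord2.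
have cl l m x := @sphere_coord2_le1 x l m.
split; last first.
  have := sphere_rotation (turn ij) (mc i i) (cl i i).
  by under eq_Rintegral do rewrite quarter_turnE tpermL (negbTE ij) mulr1.
have := sphere_rotation (turn ij) (mc i j) (cl i j).
under eq_Rintegral do rewrite !quarter_turnE tpermL tpermR (negbTE ij) eqxx mulr1
  mulrN1 mulrN -mulrN1 [_ 0 j * _]mulrC.
rewrite RintegralZr; last 2 first.
- exact: measurable_sphere.
- exact: sphere_integrable (mc i j) (cl i j).
by lra.
Qed.

Lemma sphere_integral_cst (r : R) : \int[sigma]_(x in sphere R d) r = r.
Proof.
have [S1 _] := hsigma; have mS := @measurable_sphere R d.
by rewrite (Rintegral_cst sigma mS) [X in fine X]S1 mulr1.
Qed.

(** The [d.+1] diagonal moments are equal, and they sum to 1 because the squared norm is 1 on the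
    sphere. *)
Lemma sphere_integral_coord2 i j :
  \int[sigma]_(x in sphere R d) (x 0 i * x 0 j) = (i == j)%:R / d.+1%:R.
Proof.
have [<-{j}|ij] := eqVneq i j; last by rewrite mul0r (sphere_integral_offdiag ij).1.
have mc := measurable_coord2; have cl l m x := @sphere_coord2_le1 x l m.
have E : \sum_(l < d.+1) \int[sigma]_(x in sphere R d) (x 0 l * x 0 l) = 1.
  rewrite -Rintegral_sum; last 2 first.
  - exact: measurable_sphere.
  - by move=> l; exact: sphere_integrable (mc l l) (cl l l).
  rewrite -[RHS](sphere_integral_cst 1); apply: eq_Rintegral => x; rewrite inE => Sx.
  under eq_bigr do rewrite -expr2.
  by rewrite -eucl_normE Sx expr1n.
have d0 : (d.+1%:R : R) != 0 by rewrite pnatr_eq0.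
apply: (mulIf d0); rewrite /= mulr1n divfK// -[RHS]E.
transitivity (\sum_(l < d.+1) \int[sigma]_(x in sphere R d) (x 0 i * x 0 i)).
  by rewrite sumr_const card_ord mulr_natr.
apply: eq_bigr => l _; have [->//|il] := eqVneq i l.
by rewrite (sphere_integral_offdiag il).2.
Qed.

End SphereMoments.

(** * The trigonometric curve *)

Section Harmonics.
Context {R : realType}.
Notation mu := (@lebesgue_measure R).

Lemma lipschitz_of_derive (f df : R -> R) (M : R) :
  (forall x : R, is_derive x 1 f (df x)) -> (forall x, `|df x| <= M) ->
  forall x y, `|f x - f y| <= M * `|x - y|.
Proof.
move=> fd dfM x y; wlog xy : x y / y <= x => [hw|].
  have [|/ltW] := leP y x; first exact: hw.
  by rewrite distrC [`|x - y|]distrC; exact: hw.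
have [|z _ ->] := @MVT_segment R f df y x xy.
  apply: continuous_subspaceT => z.
  apply/differentiable_continuous/derivable1_diffP.
  exact: (@ex_derive _ _ _ _ _ _ _ (fd z)).
by rewrite normrM ler_wpM2r.
Qed.

Lemma is_derive_affine_cos (r a b x : R) :
  is_derive x 1 (fun t => r * cos (a * t + b)) (- r * a * sin (a * x + b)).
Proof.
by apply: is_derive_eq; rewrite /GRing.scale/=; ring.
Qed.

Lemma is_derive_affine_sin (r a b x : R) :
  is_derive x 1 (fun t => r * sin (a * t + b)) (r * a * cos (a * x + b)).
Proof.
by apply: is_derive_eq; rewrite /GRing.scale/=; ring.
Qed.

Lemma continuous_affine_cos (a b : R) : continuous (fun t => cos (a * t + b)).
Proof.
move=> x; have := is_derive_affine_cos 1 a b x.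
under [X in is_derive _ _ X]eq_fun do rewrite mul1r.
move=> dx; apply/differentiable_continuous/derivable1_diffP.
exact: (@ex_derive _ _ _ _ _ _ _ dx).
Qed.

Lemma integrable_affine_cos (a b : R) :
  mu.-integrable `[0, 2 * pi[ (EFin \o (fun t => cos (a * t + b))).
Proof.
apply: (@le_integrable_bounded _ _ _ _ _ _ 1) => //; last by move=> x _; exact: cos_max.
  exact: lebesgue_measure_itv_lty.
apply: (@measurable_funS _ _ _ _ setT) => //.
by apply: continuous_measurable_fun; exact: continuous_affine_cos.
Qed.

(** The primitive [a^-1 * sin (a * t + b)] takes the same value at both ends. *)
Lemma Rintegral_affine_cos (a b : R) : a != 0 -> sin (a * (2 * pi) + b) = sin b ->
  \int[mu]_(t in `[0, 2 * pi[) cos (a * t + b) = 0.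
Proof.
move=> a0 sab; rewrite Rintegral_itv_bndo_bndc; last exact: integrable_affine_cos.
have F t := is_derive_affine_sin a^-1 a b t.
have Fc : continuous (fun t => a^-1 * sin (a * t + b)).
  move=> x; apply/differentiable_continuous/derivable1_diffP.
  exact: (@ex_derive _ _ _ _ _ _ _ (F x)).
rewrite /Rintegral (@continuous_FTC2 R _ (fun t => a^-1 * sin (a * t + b)) 0 (2 * pi)).
- by rewrite sab mulr0 add0r -EFinB subrr.
- by rewrite mulr_gt0 ?pi_gt0.
- by apply: continuous_subspaceT; exact: continuous_affine_cos.
- split.
  + by move=> x _; exact: (@ex_derive _ _ _ _ _ _ _ (F x)).
  + by apply: cvg_at_right_filter; exact: Fc.
  + by apply: cvg_at_left_filter; exact: Fc.
- move=> x _; rewrite derive1E (@derive_val _ _ _ _ _ _ _ (F x)).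
  by rewrite mulVf// mul1r.
Qed.

End Harmonics.

Section TrigCurve.
Context {R : realType}.
Notation mu := (@lebesgue_measure R).
Variable k : nat.
Hypothesis k0 : (0 < k)%N.
Notation c := (@trig_curve R k).

Let s : R := (Num.sqrt k%:R)^-1.

Definition trig_freq (j : nat) : R := (j./2.+1)%:R.
(* sin x = cos (x - pi / 2) makes every coordinate a cosine. *)
Definition trig_phase (j : nat) : R := if odd j then - (pi / 2) else 0.

Let kR : (0 : R) < k%:R. Proof. by rewrite ltr0n. Qed.

Let s2 : s ^+ 2 = k%:R^-1.
Proof. by rewrite /s exprVn sqr_sqrtr. Qed.

Let s_ge0 : 0 <= s. Proof. by rewrite invr_ge0 sqrtr_ge0. Qed.

Let s_le1 : s <= 1.
Proof.
rewrite -(@ler_pXn2r _ 2)// ?nnegrE// s2 expr1n invf_le1//.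
by rewrite ler1n.
Qed.

Lemma trig_curve_coordE t j : c t 0 j = s * cos (trig_freq j * t + trig_phase j).
Proof.
rewrite /trig_curve !mxE -/s /trig_phase /trig_freq.
by case: ifP => _; rewrite ?cosBpihalf ?addr0.
Qed.

Lemma trig_freq_le j : (j < (2 * k - 1).+1)%N -> trig_freq j <= k%:R.
Proof. by move=> jk; rewrite /trig_freq ler_nat; lia. Qed.

Let coord_derive (j : 'I_(2 * k - 1).+1) (t : R) : is_derive t 1 (fun t => c t 0 j)
  (- s * trig_freq j * sin (trig_freq j * t + trig_phase j)).
Proof.
under [X in is_derive _ _ X]eq_fun do rewrite trig_curve_coordE.
exact: is_derive_affine_cos.
Qed.

Lemma trig_curve_lipschitz j x y : `|c x 0 j - c y 0 j| <= k%:R * `|x - y|.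
Proof.
apply: (lipschitz_of_derive (coord_derive j)) => z.
rewrite !normrM normrN [`|s|]ger0_norm// [`|trig_freq j|]ger0_norm//.
rewrite -[leRHS]mulr1 ler_pM ?mulr_ge0 ?sin_max//.
by rewrite -[leRHS]mul1r ler_pM// trig_freq_le.
Qed.

Lemma sum_even_odd (F : nat -> R) n :
  \sum_(0 <= j < 2 * n) F j = \sum_(0 <= m < n) (F (2 * m)%N + F (2 * m).+1).
Proof.
elim: n => [|n ih]; first by rewrite muln0 !big_nil.
by rewrite mulnS add2n !big_nat_recr//= ih addrA.
Qed.

(** Grouping the two coordinates of equal frequency makes cos^2 + sin^2 = 1 applicable. *)
Lemma sum_coord_pairs (F : nat -> R) :
  \sum_(j < (2 * k - 1).+1) F j = \sum_(0 <= m < k) (F (2 * m)%N + F (2 * m).+1).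
Proof.
by rewrite -sum_even_odd -(big_mkord xpredT F); congr bigop; congr index_iota; lia.
Qed.

Let freq_even m : trig_freq (2 * m)%N = m.+1%:R.
Proof. by rewrite /trig_freq mul2n doubleK. Qed.
Let freq_odd m : trig_freq (2 * m).+1 = m.+1%:R.
Proof. by rewrite /trig_freq mul2n /= uphalf_double. Qed.
Let phase_even m : trig_phase (2 * m)%N = 0.
Proof. by rewrite /trig_phase mul2n odd_double. Qed.
Let phase_odd m : trig_phase (2 * m).+1 = - (pi / 2).
Proof. by rewrite /trig_phase mul2n /= odd_double. Qed.

Lemma trig_curve_sphere t : sphere R (2 * k - 1) (c t).
Proof.
rewrite /sphere /= -[RHS]sqrtr1; congr Num.sqrt.
under eq_bigr do rewrite trig_curve_coordE.
rewrite (sum_coord_pairs (fun j => (s * cos (trig_freq j * t + trig_phase j)) ^+ 2)).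
under eq_bigr do rewrite freq_even freq_odd phase_even phase_odd cosBpihalf addr0
  !exprMn -mulrDr cos2Dsin2 mulr1 s2.
by rewrite sumr_const_nat subn0 -[LHS]mulr_natr mulVf// gt_eqF.
Qed.

Definition trig_speed : R := Num.sqrt (A2 R k / B2 R k).

(** Differentiation scales the pair of frequency n by n, up to a quarter turn, so this pair adds n^2
    / k to the squared speed at every [t]. *)
Lemma trig_curve_speed t : speed c t = trig_speed.
Proof.
have dc : derivable c t 1.
  apply/derivable_mxP => i j; rewrite ord1.
  exact: (@ex_derive _ _ _ _ _ _ _ (coord_derive j t)).
rewrite /speed derive1E derive_mx//; congr Num.sqrt.
under eq_bigr do rewrite mxE (@derive_val _ _ _ _ _ _ _ (coord_derive _ t)).
rewrite (sum_coord_pairs (fun j =>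
  (- s * trig_freq j * sin (trig_freq j * t + trig_phase j)) ^+ 2)).
under eq_bigr => m _.
  rewrite freq_even freq_odd phase_even phase_odd sinBpihalf addr0.
  rewrite !exprMn sqrrN -mulrDr sqrrN addrC cos2Dsin2 mulr1 s2.
over.
rewrite -mulr_sumr /A2 /B2 big_add1 /= mulrC.
have := lt0r_neq0 kR; move: (k%:R : R) (\sum_(_ <= _ < _) _) => K S K0.
by field.
Qed.

Lemma trig_curve_length : curve_length c = 2 * pi * trig_speed.
Proof.
rewrite /curve_length; under eq_Rintegral do rewrite trig_curve_speed.
rewrite Rintegral_cst//.
rewrite [X in _ * X](_ : _ = 2 * pi - 0); first by rewrite subr0 mulrC.
by apply: fine_lebesgue_measure_itv; rewrite ltW// twopi_gt0.
Qed.

Lemma trig_speed_gt0 : 0 < trig_speed.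
Proof.
rewrite sqrtr_gt0 divr_gt0 ?mulr_gt0// big_ltn// ltr_pwDl ?exprn_gt0//.
by apply: sumr_ge0 => m _; exact: sqr_ge0.
Qed.

Lemma trig_curve_closed : closed_lipschitz_curve c.
Proof.
have cont : continuous c.
  apply: continuous_rowP => j; apply: lipschitz_real_continuous.
  exact: trig_curve_lipschitz.
split.
- by move=> t _; exact: trig_curve_sphere.
- exists k%:R; split; first exact: num_real.
  move=> M kM [x y] _ /=.
  rewrite {1}/Num.Def.normr/= mx_normrE bigmax_le//= => [|[i j] _].
    by rewrite mulr_ge0// ltW// (lt_trans kR).
  rewrite ord1 mxE [X in _ + X]mxE (le_trans (trig_curve_lipschitz _ _ _))//.
  by rewrite ler_wpM2r// ltW.
- rewrite (_ : c 0 = c (2 * pi)).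
    by apply: cvg_at_left_filter; exact: cont.
  apply/rowP => j; rewrite !trig_curve_coordE mulr0 addrC [_ * (2 * pi) + _]addrC.
  by rewrite [_ * (2 * pi)]mulrC cosDn2pi addr0.
Qed.

Lemma trig_curve_mean j : \int[mu]_(t in `[0, 2 * pi[) (c t 0 j) = 0.
Proof.
under eq_Rintegral do rewrite trig_curve_coordE.
rewrite RintegralZl//; last exact: integrable_affine_cos.
rewrite Rintegral_affine_cos ?mulr0//; first by rewrite pnatr_eq0.
by rewrite [_ * (2 * pi)]mulrC addrC sinDn2pi.
Qed.

(** Product-to-sum formula: the term with the sum of the frequencies integrates to 0, and the one
    with their difference survives only for equal frequencies. *)
Lemma trig_curve_moment i j :
  \int[mu]_(t in `[0, 2 * pi[) (c t 0 i * c t 0 j) =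
  2 * pi * ((i == j)%:R / (2 * k - 1).+1%:R).
Proof.
pose a := trig_freq i + trig_freq j; pose b := trig_phase i + trig_phase j.
pose a' := trig_freq i - trig_freq j; pose b' := trig_phase i - trig_phase j.
have E t : c t 0 i * c t 0 j = s ^+ 2 / 2 * (cos (a * t + b) + cos (a' * t + b')).
  pose x := trig_freq i * t + trig_phase i; pose y := trig_freq j * t + trig_phase j.
  rewrite !trig_curve_coordE -/x -/y.
  rewrite (_ : a * t + b = x + y); last by rewrite /a /b /x /y; ring.
  rewrite (_ : a' * t + b' = x - y); last by rewrite /a' /b' /x /y; ring.
  by move: x y => x y; rewrite cosD cosB; field.
under eq_Rintegral do rewrite E.
rewrite RintegralZl//; last first.
  under [X in _.-integrable _ X]eq_fun do rewrite /= EFinD.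
  by apply: integrableD => //; exact: integrable_affine_cos.
rewrite RintegralD//; [|exact: integrable_affine_cos..].
rewrite Rintegral_affine_cos ?add0r; last 2 first.
- by rewrite /a -natrD pnatr_eq0.
- by rewrite /a -natrD [_ * (2 * pi)]mulrC addrC sinDn2pi.
have nk : ((2 * k - 1).+1%:R : R) = 2 * k%:R by rewrite -natrM; congr _%:R; lia.
have [fij|fij] := eqVneq (trig_freq i) (trig_freq j); last first.
  rewrite Rintegral_affine_cos; last 2 first.
  - by rewrite subr_eq0.
  (* The difference of frequencies may be negative, so a natural number of periods is added on each
     side. *)
  - rewrite -[LHS](sinDn2pi _ (j./2.+1)) -[RHS](sinDn2pi _ (i./2.+1)); congr sin.
    by rewrite /a' /trig_freq; ring.
  rewrite mulr0; case: eqVneq => [ij|_]; last by rewrite mul0r mulr0.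
  by rewrite ij eqxx in fij.
have a'0 : a' = 0 by rewrite /a' fij subrr.
under eq_Rintegral do rewrite a'0 mul0r add0r.
rewrite Rintegral_cst// [X in _ * (_ * X)](_ : _ = 2 * pi - 0); last first.
  by apply: fine_lebesgue_measure_itv; rewrite ltW// twopi_gt0.
(* At equal frequency, distinct coordinates are a cosine and a sine, with phases pi / 2 apart. *)
have -> : cos b' = (i == j)%:R.
  move/eqP: fij; rewrite /trig_freq eqr_nat => /eqP[hij].
  have -> : (i == j) = (odd i == odd j).
    apply/eqP/eqP => [->//|oij]; apply: val_inj => /=.
    by rewrite -(odd_double_half i) -(odd_double_half j) hij oij.
  rewrite /b' /trig_phase; case: (odd i); case: (odd j); rewrite /= ?subrr ?cos0//.
    by rewrite subr0 cosN cos_pihalf.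
  by rewrite sub0r opprK cos_pihalf.
rewrite nk s2 subr0; have := lt0r_neq0 kR.
by move: (k%:R : R) (pi : R) (_%:R : R) => K p D K0; field.
Qed.

End TrigCurve.

(** * From first and second moments to polynomials of degree at most 2, and back *)

Section DesignOfMoments.
Context {R : realType} {d : nat}.
Notation mu := (@lebesgue_measure R).
Variable sigma : probability (borel_rV R d.+1) R.
Hypothesis hsigma : uniform_on_sphere sigma.
Hypothesis d0 : (0 < d)%N.
Variable c : R -> 'rV[R]_d.+1.
Hypothesis c_cont : continuous c.
Hypothesis c_sphere : forall t, sphere R d (c t).
Hypothesis c_mean : forall i, \int[mu]_(t in `[0, 2 * pi[) (c t 0 i) = 0.
Hypothesis c_moment : forall i j,
  \int[mu]_(t in `[0, 2 * pi[) (c t 0 i * c t 0 j) = 2 * pi * ((i == j)%:R / d.+1%:R).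

Let coords (x : 'rV[R]_d.+1) (i : 'I_d.+1) := x 0 i.

(** Stated for functions of the coordinate vector, so that one [F] is evaluated on both the curve
    and the sphere; integrability is included to make the property stable under linear
    combinations. *)
Let exact_on (F : ('I_d.+1 -> R) -> R) :=
  [/\ sigma.-integrable (sphere R d) (EFin \o (fun x => F (coords x))),
      mu.-integrable `[0, 2 * pi[ (EFin \o (fun t => F (coords (c t)))) &
      \int[mu]_(t in `[0, 2 * pi[) F (coords (c t)) =
      2 * pi * \int[sigma]_(x in sphere R d) F (coords x)].

Let exact_onD F G : exact_on F -> exact_on G -> exact_on (fun v => F v + G v).
Proof.
move=> [F1 F2 F3] [G1 G2 G3]; have mS := @measurable_sphere R d.
have mI : measurable (`[0, 2 * pi[%classic : set (measurableTypeR R)) by [].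
split.
- under [X in _.-integrable _ X]eq_fun do rewrite /= EFinD.
  exact: (integrableD mS F1 G1).
- under [X in _.-integrable _ X]eq_fun do rewrite /= EFinD.
  exact: (integrableD mI F2 G2).
- by rewrite (RintegralD mI F2 G2) (RintegralD mS F1 G1) F3 G3 -[LHS]mulrDr.
Qed.

Let exact_onZ r F : exact_on F -> exact_on (fun v => r * F v).
Proof.
move=> [F1 F2 F3]; have mS := @measurable_sphere R d.
have mI : measurable (`[0, 2 * pi[%classic : set (measurableTypeR R)) by [].
split.
- under [X in _.-integrable _ X]eq_fun do rewrite /= EFinM.
  exact: (integrableZl mS r F1).
- under [X in _.-integrable _ X]eq_fun do rewrite /= EFinM.
  exact: (integrableZl mI r F2).
- by rewrite (RintegralZl r mI F2) (RintegralZl r mS F1) F3 [LHS]mulrCA.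
Qed.

Let exact_on_bounded F : continuous (fun x : 'rV[R]_d.+1 => F (coords x)) ->
  (forall x, sphere R d x -> `|F (coords x)| <= 1) ->
  \int[mu]_(t in `[0, 2 * pi[) F (coords (c t)) =
  2 * pi * \int[sigma]_(x in sphere R d) F (coords x) -> exact_on F.
Proof.
move=> cF F1 FE; split => //.
  by apply: sphere_integrable F1; exact: continuous_borel_rV.
apply: (@le_integrable_bounded _ _ _ _ _ _ 1) => //.
- exact: lebesgue_measure_itv_lty.
- apply: (@measurable_funS _ _ _ _ setT) => //; apply: continuous_measurable_fun.
  move=> t; apply: (@continuous_comp _ _ _ c (fun x => F (coords x))).
    exact: c_cont.
  exact: cF.
- by move=> t _; exact: F1.
Qed.

Let exact_on_cst : exact_on (fun=> 1).
Proof.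
apply: exact_on_bounded => [|x _|]; first exact: cst_continuous.
  by rewrite normr1.
rewrite sphere_integral_cst// Rintegral_cst// mulr1 mul1r.
by rewrite [LHS]fine_lebesgue_measure_itv ?subr0// ltW// twopi_gt0.
Qed.

Let exact_on_coord i : exact_on (fun v => v i).
Proof.
apply: exact_on_bounded; first exact: coord_continuous.
  by move=> x; exact: sphere_coord_le1.
by rewrite /coords c_mean sphere_integral_coord// mulr0.
Qed.

Let exact_on_coord2 i j : exact_on (fun v => v i * v j).
Proof.
apply: exact_on_bounded.
- by move=> x; apply: (@cvgM _ _ _ (nbhs_filter x)); exact: coord_continuous.
- by move=> x; exact: sphere_coord2_le1.
- by rewrite /coords c_moment sphere_integral_coord2.
Qed.

Let prod_coord (v : 'I_d.+1 -> R) (m : 'I_d.+1 -> nat) i : (0 < m i)%N ->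
  \prod_j v j ^+ m j = v i * \prod_j v j ^+ (m j - (i == j)).
Proof.
move=> mi; rewrite (bigD1 i)//= [in RHS](bigD1 i)//= eqxx mulrA -exprS subn1 prednK//.
congr (_ * _); apply: eq_bigr => j ji.
by rewrite eq_sym (negbTE ji) subn0.
Qed.

Let sum_coord (m : 'I_d.+1 -> nat) i : (0 < m i)%N ->
  (\sum_j m j = (\sum_j (m j - (i == j))).+1)%N.
Proof.
move=> mi; rewrite (bigD1 i)//= [in RHS](bigD1 i)//= eqxx subn1 -addSn prednK//.
congr (_ + _)%N; apply: eq_bigr => j ji.
by rewrite eq_sym (negbTE ji) subn0.
Qed.

(** Peeling off one coordinate of positive exponent at a time leaves 1, one coordinate, or a product
    of two coordinates. *)
Let exact_on_monomial (m : 'I_d.+1 -> nat) : (\sum_i m i <= 2)%N ->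
  exact_on (fun v => \prod_i v i ^+ m i).
Proof.
have zero m' v : (forall i, m' i = 0%N) -> \prod_(i < d.+1) v i ^+ m' i = 1 :> R.
  by move=> m0; rewrite big1// => i _; rewrite m0 expr0.
have [m0 _|] := boolP [forall i, m i == 0%N].
  rewrite (_ : (fun _ => _) = fun=> 1)//; apply/funext => v; apply: zero => i.
  by apply/eqP/(forallP m0).
rewrite negb_forall => /existsP[i]; rewrite -lt0n => mi.
rewrite (sum_coord mi) ltnS; set m1 := fun j => (m j - (i == j))%N => m1le.
have [m10|] := boolP [forall i, m1 i == 0%N].
  rewrite (_ : (fun _ => _) = fun v => v i)//; apply/funext => v.
  by rewrite (prod_coord _ mi) zero ?mulr1// => j; apply/eqP/(forallP m10).
rewrite negb_forall => /existsP[j]; rewrite -lt0n => m1j.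
move: m1le; rewrite (sum_coord m1j) ltnS leqn0 sum_nat_eq0 => /forallP m2.
rewrite (_ : (fun _ => _) = fun v => v i * v j)//; apply/funext => v.
rewrite (prod_coord _ mi) (prod_coord v m1j) zero ?mulr1// => l.
exact/eqP/(implyP (m2 l)).
Qed.

Lemma exact_on_mpoly (p : mpoly.mpoly d.+1 R) : (mpoly.msize p <= 3)%N ->
  mu.-integrable `[0, 2 * pi[ (EFin \o (fun t => mpoly.meval (fun i => c t 0 i) p)) /\
  \int[mu]_(t in `[0, 2 * pi[) (mpoly.meval (fun i => c t 0 i) p) =
  2 * pi * \int[sigma]_(x in sphere R d) (mpoly.meval (fun i => x 0 i) p).
Proof.
move=> p3; suff : exact_on (fun v => mpoly.meval v p).
  by case=> _ int e; split; [exact: int|exact: e].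
have pm m : m \in mpoly.msupp p -> (\sum_i m i <= 2)%N.
  by move=> /mpoly.msize_mdeg_lt mp; have := leq_trans mp p3; rewrite ltnS mpoly.mdegE.
under [X in exact_on X]eq_fun do rewrite mpoly.mevalE.
elim: (mpoly.msupp p : seq _) pm => [_|m l ih pm].
  (* The empty sum is written as a multiple of the constant 1, for which exactness is known. *)
  rewrite (_ : (fun _ => _) = fun=> 0 * 1); first exact: exact_onZ.
  by apply/funext => v; rewrite big_nil mul0r.
under [X in exact_on X]eq_fun do rewrite big_cons.
apply: exact_onD.
  by apply: exact_onZ; apply: exact_on_monomial; apply: pm; rewrite mem_head.
by apply: ih => m' m'l; apply: pm; rewrite inE m'l orbT.
Qed.

End DesignOfMoments.

(** The design identity is tested on the monomials X_i and X_i X_l, whose integrals over the sphere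
    are known. *)
Lemma curve_moments_of_design (R : realType) (d : nat)
    (sigma : probability (borel_rV R d.+1) R) (c : R -> 'rV[R]_d.+1) :
  uniform_on_sphere sigma -> (0 < d)%N -> design_curve sigma 2 c ->
  (forall i, \int[@lebesgue_measure R]_(t in `[0, 2 * pi[) (c t 0 i * speed c t) = 0) /\
  (forall i l, \int[@lebesgue_measure R]_(t in `[0, 2 * pi[)
     (c t 0 i * c t 0 l * speed c t) = curve_length c * ((i == l)%:R / d.+1%:R)).
Proof.
move=> hsigma d0 [_ L0 cd]; have Ln0 := lt0r_neq0 L0.
have msX (m : mpoly.multinom d.+1) : (mpoly.mdeg m <= 2)%N ->
    (mpoly.msize (mpoly.mpolyX R m) <= 3)%N.
  by rewrite mpoly.msizeX ltnS.
split=> [i|i l].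
- have := cd (fun x => x 0 i); rewrite sphere_integral_coord// => e.
  apply: (mulfI (invr_neq0 Ln0)); rewrite mulr0 -e//.
  exists (mpoly.mpolyX R (mpoly.mnm1 i)); first by rewrite msX// mpoly.mdeg1.
  by move=> x _; rewrite mpoly.mevalXU.
- have := cd (fun x => x 0 i * x 0 l); rewrite sphere_integral_coord2// => e.
  apply: (mulfI (invr_neq0 Ln0)); rewrite mulKf// -e//.
  exists (mpoly.mpolyX R (mpoly.mnm_add (mpoly.mnm1 i) (mpoly.mnm1 l))).
    by rewrite msX// mpoly.mdegD !mpoly.mdeg1.
  by move=> x _; rewrite mpoly.mpolyXD mpoly.mevalM !mpoly.mevalXU.
Qed.

Lemma trig_curve_design (R : realType) (k : nat)
    (sigma : probability (borel_rV R (2 * k - 1).+1) R) : (0 < k)%N ->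
  uniform_on_sphere sigma -> design_curve sigma 2 (@trig_curve R k).
Proof.
move=> k0 hsigma; set c := @trig_curve R k.
have d0 : (0 < 2 * k - 1)%N by lia.
have v0 : 0 < trig_speed k :> R by exact: trig_speed_gt0.
have cS t : sphere R (2 * k - 1) (c t) by exact: trig_curve_sphere.
have cc : continuous c.
  by apply: continuous_rowP => j; apply: lipschitz_real_continuous;
    exact: trig_curve_lipschitz.
split; first exact: trig_curve_closed.
  by rewrite trig_curve_length// mulr_gt0// twopi_gt0.
move=> f [p p3 fp].
transitivity (\int[sigma]_(x in sphere R (2 * k - 1)) mpoly.meval (fun i => x 0 i) p).
  by apply: eq_Rintegral => x; rewrite inE => /fp.
have [ci e] := exact_on_mpoly hsigma d0 cc cS (@trig_curve_mean R k)
  (trig_curve_moment k0) p3.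
(* The speed is constant, so it cancels against the length and leaves the average over the
   parameter. *)
under [in RHS]eq_Rintegral do rewrite trig_curve_speed// fp//.
rewrite RintegralZr// e trig_curve_length//.
rewrite [X in _^-1 * X]mulrAC mulKf// mulf_neq0 ?lt0r_neq0//.
exact: twopi_gt0.
Qed.

Theorem mainTheorem2 (R : realType) (k : nat) (hk : (1 <= k)%N)
    (sigma : probability (borel_rV R (2 * k - 1).+1) R)
    (hsigma : uniform_on_sphere sigma) :
  [/\ design_curve sigma 2 (@trig_curve R k),
      curve_length (@trig_curve R k) = 2 * pi * Num.sqrt (A2 R k / B2 R k),
      forall c : R -> 'rV[R]_(2 * k - 1).+1, design_curve sigma 2 c ->
        2 * pi * Num.sqrt (A2 R k / B2 R k) <= curve_length c &
      forall c : R -> 'rV[R]_(2 * k - 1).+1, design_curve sigma 2 c ->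
        curve_length (@trig_curve R k) <= curve_length c].
Proof.
have dk : (2 * k - 1).+1 = (2 * k)%N by lia.
have d0 : (0 < 2 * k - 1)%N by lia.
have trig_len : curve_length (@trig_curve R k) = 2 * pi * Num.sqrt (A2 R k / B2 R k).
  exact: trig_curve_length.
have lower (c : R -> 'rV[R]_(2 * k - 1).+1) : design_curve sigma 2 c ->
    2 * pi * Num.sqrt (A2 R k / B2 R k) <= curve_length c.
  move=> cd; have [c1 c2] := curve_moments_of_design hsigma d0 cd.
  by have [cc L0 _] := cd; exact: isotropic_curve_length_ge.
split; [exact: trig_curve_design|exact: trig_len|exact: lower|].
by move=> c /lower; rewrite -trig_len.
Qed.
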